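(* For every fixed constant $n\ge 2$, the decision problem \textsc{Optimal Exchanges}, restricted to instances with exactly $n$ agents having binary utilities, is in P.
   Context: Let $N=\{1,\dots,n\}$ be a set of $n\ge 2$ agents and $M$ a set of $m\ge 1$ indivisible goods. Each agent $i$ has an additive utility function $u_i:2^M\to\mathbb{R}_{\ge 0}$, i.e., $u_i(M')=\sum_{g\in M'}u_i(\{g\})$. An instance consists of $N$, $M$ and $(u_i)_{i\in N}$. Utilities are binary if $u_i(\{g\})\in\{0,1\}$ for all $i\in N$, $g\in M$. An allocation $\mathcal{A}=(A_1,\dots,A_n)$ is an ordered partition of $M$ into $n$ (possibly empty) bundles, $A_i$ going to agent $i$. Agent $i$ is EF1 towards agent $j$ in $\mathcal{A}$ if $A_j=\varnothing$ or there exists $g\in A_j$ with $u_i(A_i)\ge u_i(A_j\setminus\{g\})$. $\mathcal{A}$ is EF1 if every agent is EF1 towards every other agent. An exchange transforms an allocation $\mathcal{A}$ into an allocation $\mathcal{B}$ where, for some distinct $i,j\in N$, $g\in A_i$, $g'\in A_j$, we have $B_i=(A_i\cup\{g'\})\setminus\{g\}$, $B_j=(A_j\cup\{g\})\setminus\{g'\}$, and $B_k=A_k$ for $k\ne i,j$. The optimal number of exchanges required to reach an EF1 allocation from $\mathcal{A}$ is the smallest $T\ge 0$ such that some sequence of $T$ exchanges starting at $\mathcal{A}$ ends in an EF1 allocation ($\infty$ if none exists). \textsc{Optimal Exchanges}: given an instance (utilities listed good by good for each agent), an initial allocation $\mathcal{A}$, and a number $k$, decide whether the optimal number of exchanges required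 to reach an EF1 allocation from $\mathcal{A}$ is at most $k$. *)

(* Defs.v *)
From HB Require Import structures.
From mathcomp Require Import all_boot all_order all_algebra.
From mathcomp Require Import boolp reals.

Set Implicit Arguments.
Unset Strict Implicit.
Unset Printing Implicit Defensive.

Import Order.TTheory GRing.Theory Num.Theory.

Inductive direction := MoveLeft | Stay | MoveRight.

Section Machines.
Variable sigma : finType.

(* Deterministic multi-tape Turing machines.  [tm_result q = None] means that
   [q] is a running state; [Some true] / [Some false] are accepting / rejecting
   halting states.  The tape alphabet is the input alphabet, a disjoint finite
   set of auxiliary symbols, and the blank [None]. *)
Record machine := Machine {
  tm_extra_tapes : nat;
  tm_state : finType;
  tm_work : finType;
  tm_start : tm_state;
  tm_result : tm_state -> option bool;
  tm_trans : tm_state ->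
    {ffun 'I_tm_extra_tapes.+1 -> option (sigma + tm_work)} ->
    tm_state *
      ('I_tm_extra_tapes.+1 -> option (sigma + tm_work) * direction)
}.

Definition tm_symbol (M : machine) := option (sigma + tm_work M).

(* A two-way infinite tape: the cells left of the head (nearest first), the
   scanned cell, the cells right of the head (nearest first).  All cells beyond
   the two lists are blank. *)
Record tape (M : machine) := Tape {
  tp_left : seq (tm_symbol M);
  tp_head : tm_symbol M;
  tp_right : seq (tm_symbol M)
}.

Definition tape_write M (a : tm_symbol M) (t : tape M) : tape M :=
  Tape (tp_left t) a (tp_right t).

Definition tape_move M (d : direction) (t : tape M) : tape M :=
  match d with
  | MoveLeft => Tape (behead (tp_left t)) (head None (tp_left t))
                     (tp_head t :: tp_right t)
  | Stay => t
  | MoveRight => Tape (tp_head t :: tp_left t) (head None (tp_right t))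
                      (behead (tp_right t))
  end.

Record config (M : machine) := Config {
  cf_state : tm_state M;
  cf_tapes : 'I_(tm_extra_tapes M).+1 -> tape M
}.

(* Halted configurations are fixed points, so "halts within t steps" can be read
   off the configuration after exactly t iterations. *)
Definition tm_step M (c : config M) : config M :=
  if tm_result (cf_state c) is Some _ then c else
  let r := tm_trans (cf_state c) [ffun i => tp_head (cf_tapes c i)] in
  Config r.1
    (fun i => tape_move (r.2 i).2 (tape_write (r.2 i).1 (cf_tapes c i))).

Definition input_tape M (w : seq sigma) : tape M :=
  let s : seq (tm_symbol M) := [seq Some (inl x) | x <- w] in
  Tape [::] (head None s) (behead s).

Definition blank_tape M : tape M := Tape [::] None [::].

Definition tm_init M (w : seq sigma) : config M :=
  Config (tm_start M)
    (fun i => if i == ord0 then input_tape M w else blank_tape M).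

Definition tm_outcome M (w : seq sigma) (t : nat) : option bool :=
  tm_result (cf_state (iter t (@tm_step M) (tm_init M w))).

Definition in_P (L : seq sigma -> Prop) : Prop :=
  exists (M : machine) (c d : nat), forall w : seq sigma,
    exists b : bool,
      tm_outcome M w (c * size w ^ d + c) = Some b /\ (b <-> L w).

End Machines.

Section Allocations.
Local Open Scope ring_scope.
Variables (R : realType) (n m : nat).

Definition bundles := {ffun 'I_n -> {set 'I_m}}.

Definition is_allocation (A : bundles) : bool :=
  (\bigcup_i A i == [set: 'I_m]) &&
  [forall i, forall j, (i != j) ==> [disjoint A i & A j]].

Definition utility_of (u : 'I_n -> 'I_m -> R) (i : 'I_n) (S : {set 'I_m}) : R :=
  \sum_(g in S) u i g.

Definition EF1_towards (u : 'I_n -> 'I_m -> R) (A : bundles) (i j : 'I_n) :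
    bool :=
  (A j == set0) ||
  [exists g in A j, utility_of u i (A i) >= utility_of u i (A j :\ g)].

Definition EF1 (u : 'I_n -> 'I_m -> R) (A : bundles) : bool :=
  [forall i, forall j, (i != j) ==> EF1_towards u A i j].

Definition exchange (A B : bundles) : bool :=
  [exists i, exists j, exists g in A i, exists g' in A j,
    [&& i != j,
        B i == (g' |: A i) :\ g,
        B j == (g |: A j) :\ g'
      & [forall k, (k != i) && (k != j) ==> (B k == A k)]]].

Definition EF1_reachable_in (u : 'I_n -> 'I_m -> R) (A : bundles) (T : nat) :
    bool :=
  [exists s : T.-tuple bundles, path exchange A s && EF1 u (last A s)].

(* [None] stands for infinity. *)
Definition optimal_exchanges (u : 'I_n -> 'I_m -> R) (A : bundles) :
    option nat :=
  if pselect (exists T, EF1_reachable_in u A T) is left ex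
  then Some (ex_minn ex) else None.

Record instance := Instance {
  utility : 'I_n -> 'I_m -> R;
  utility_ge0 : forall i g, 0 <= utility i g;
  initial : bundles;
  initial_alloc : is_allocation initial;
  bound : nat
}.

Definition binary_utilities (I : instance) : Prop :=
  forall i g, utility I i g = 0 \/ utility I i g = 1.

Definition yes_instance (I : instance) : Prop :=
  if optimal_exchanges (utility I) (initial I) is Some T
  then (T <= bound I)%N else False.

End Allocations.

(* Binary expansion of [k], least significant bit first, without leading zeros
   (empty for 0). *)
Definition binary (k : nat) : seq bool :=
  mkseq (fun i => odd (k %/ 2 ^ i)) (up_log 2 k.+1).

(* Words over {0, 1, #}, with [None] for #: for each agent, the row of its
   utilities for goods 0, ..., m-1, closed by #; then, for each agent, the
   characteristic vector of its initial bundle, closed by #; then the bound in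
   binary.  The coding of a utility by one bit is lossless for binary
   utilities only. *)
Definition encode (R : realType) (n m : nat) (I : instance R n m) :
    seq (option bool) :=
  flatten [seq rcons [seq Some (utility I i g == 1%R) | g <- enum 'I_m] None
          | i <- enum 'I_n]
  ++ flatten [seq rcons [seq Some (g \in initial I i) | g <- enum 'I_m] None
             | i <- enum 'I_n]
  ++ [seq Some b | b <- binary (bound I)].

(* Optimal Exchanges for n agents with binary utilities, as a language; words
   that encode no instance are not in it. *)
Definition binary_optimal_exchanges (R : realType) (n : nat)
    (w : seq (option bool)) : Prop :=
  exists (m : nat) (I : instance R n m),
    [/\ 0 < m, binary_utilities I, w = encode I & yes_instance I].

(* Main.v *)
Require Import Defs.
From HB Require Import structures.
From mathcomp Require Import all_boot all_order all_algebra.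
From mathcomp Require Import boolp reals.
From mathcomp Require Import zify.

(* As n is fixed, there are constantly many types of goods (who likes them),
   so an allocation is described, up to exchanging goods of the same type, by
   constantly many numbers: how many goods of each type each agent owns.  Up to
   such counts an exchange is the trade of a good of type t owned by i for one
   of type t' owned by j, and envy-freeness up to one good says that
   u_i(A_j) <= u_i(A_i) + 1 for all i, j.  If an EF1 allocation is reachable,
   it is so in at most m exchanges, because one exchange puts a misplaced good
   in its place and moves only misplaced goods.  Hence dynamic programming on
   the pairs (T, counts) with T polynomially bounded decides the problem: the
   table entry says whether the counts are reached in exactly T exchanges.

   The Turing machine is compiled from a small structured language, whose
   loops carry an exponent e bounding the iterations by B^e, B = |w| + 2.
   Counters are head positions on marked tapes.  Nested loops over "rulers" of
   length B enumerate (T, counts) in lexicographic order while the head of the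
   table moves in step, so that an entry has the base-B address of its index
   and its predecessors lie at constantly many offsets, sums of +-B^k. *)

Set Implicit Arguments.
Unset Strict Implicit.
Unset Printing Implicit Defensive.

(** * Structured programs and Turing machines *)

Section Language.
Variables (sigma : finType) (K : finType).

(** Membership in P is a claim about one concrete machine, a uniform time bound and all words. Hence
    [run] states effect and time of a program together, with times that are powers of B, so that
    composing programs adds exponents. There are n * 2^n pairs of a type and an owner: the number of
    tapes, the depth of the loops and all exponents depend on n only. The value B = |w| + 2 is
    measured by one pass over the word and exceeds m + 1 on well-formed words. The bound k may be
    exponential in |w|. It stays in binary and loses one per row T of the table; since B rows cover
    T <= m, no minimum has to be computed: the answer is yes if some row T <= k contains an EF1
    entry. Words that encode no instance must be rejected as well: rows of unequal length, no goods,
    a good without exactly one owner, a missing separator, a bound with leading zeros. *)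

Definition content := nat -> option sigma.

(* A tape bounded on the left: the head position and the contents of the cells
   1, 2, ...; cell 0 holds an indelible mark, read as [None]. *)
Definition track := (nat * content)%type.
Definition store := K -> track.
Definition reading := K -> option (option sigma).
Definition action := K -> option (option sigma) * direction.

Definition scan (x : track) : option (option sigma) :=
  if x.1 is 0 then None else Some (x.2 x.1).
Definition scans (s : store) : reading := fun k => scan (s k).

Definition shift (d : direction) (p : nat) : nat :=
  match d with MoveLeft => p.-1 | Stay => p | MoveRight => p.+1 end.

Definition put (f : content) (p : nat) (c : option sigma) : content :=
  fun i => if i == p then c else f i.

Definition operate (x : track) (o : option (option sigma) * direction) : track :=
  (shift o.2 x.1,
   if (0 < x.1, o.1) is (true, Some c) then put x.2 x.1 c else x.2).

Definition tape_of (l : seq sigma) : content :=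
  fun i => if i is j.+1 then nth None (map Some l) j else None.

Lemma put_tape_of l i x : i <= size l ->
  put (tape_of l) i.+1 (Some x) = tape_of (take i l ++ x :: drop i.+1 l).
Proof.
move=> le; apply: funext => -[|j] //; rewrite /put /tape_of eqSS.
rewrite map_cat /= nth_cat size_map size_takel //.
case: (ltngtP j i) => [lt|gt|->]; last by rewrite subnn.
  by rewrite map_take nth_take.
by rewrite -(subnKC gt) addSn subSn ?leq_addr //= map_drop nth_drop addKn.
Qed.

Lemma put_tape_of_rcons l x :
  put (tape_of l) (size l).+1 (Some x) = tape_of (rcons l x).
Proof.
by rewrite put_tape_of // take_size drop_oversize ?leqnSn // cats1.
Qed.

(* The number in [Loop e] only bounds the running time: the loop may make at
   most [B ^ e] iterations, where [B] is the size parameter of [run]. *)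
Inductive prog :=
| Act of (reading -> action)
| Seq of prog & prog
| If of (reading -> bool) & prog & prog
| Loop of nat & (reading -> bool) & prog.

Fixpoint st (p : prog) : finType :=
  match p with
  | Act _ => unit : finType
  | Seq p q => (st p + st q)%type : finType
  | If _ p q => option (st p + st q)%type : finType
  | Loop _ _ p => option (st p) : finType
  end.

Fixpoint start (p : prog) : st p :=
  match p return st p with
  | Act _ => tt
  | Seq p q => inl (start p)
  | If _ p q => None
  | Loop _ _ p => None
  end.

Definition idle : action := fun _ => (None, Stay).

Fixpoint trans (p : prog) : st p -> reading -> option (st p) * action :=
  match p return st p -> reading -> option (st p) * action with
  | Act f => fun _ r => (None, f r)
  | Seq p q => fun a r => match a with
    | inl a => let x := trans a r in
        (Some (if x.1 is Some a' then inl a' else inr (start q)), x.2)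
    | inr a => let x := trans a r in (omap inr x.1, x.2)
    end
  | If b p q => fun a r => match a with
    | None => (Some (Some (if b r then inl (start p) else inr (start q))), idle)
    | Some (inl a) => let x := trans a r in (omap (Some \o inl) x.1, x.2)
    | Some (inr a) => let x := trans a r in (omap (Some \o inr) x.1, x.2)
    end
  | Loop _ b p => fun a r => match a with
    | None => (if b r then Some (Some (start p)) else None, idle)
    | Some a => let x := trans a r in (Some x.1, x.2)
    end
  end.

Definition pstep (p : prog) (x : option (st p) * store) :
    option (st p) * store :=
  if x.1 is Some a then
    let r := trans a (scans x.2) in (r.1, fun k => operate (x.2 k) (r.2 k))
  else x.

Definition reach (p : prog) (t : nat) (x y : option (st p) * store) : Prop :=
  exists2 t', t' <= t & iter t' (@pstep p) x = y.

Lemma reachD p t1 t2 x y z :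
  @reach p t1 x y -> @reach p t2 y z -> @reach p (t1 + t2) x z.
Proof.
move=> [u1 h1 <-] [u2 h2 <-]; exists (u2 + u1); first by lia.
by rewrite iterD.
Qed.

Lemma reachW p t1 t2 x y : t1 <= t2 -> @reach p t1 x y -> @reach p t2 x y.
Proof. by move=> h [u hu <-]; exists u => //; lia. Qed.

Lemma reach1 p x y : pstep x = y -> @reach p 1 x y.
Proof. by exists 1. Qed.

(** One simulation argument serves sequencing, branching and loops: [g] embeds the states of the
    part, and [e] is where the whole continues once the part halts ([None] if the whole halts
    too). *)
Lemma reach_embed p q (g : st p -> st q) (e : option (st q)) :
  (forall a r, trans (g a) r =
     (if (trans a r).1 is Some a' then Some (g a') else e, (trans a r).2)) ->
  forall t a s s', @reach p t (Some a, s) (None, s') ->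
  @reach q t (Some (g a), s) (e, s').
Proof.
move=> gE t a s s' [u hu hs]; apply: (reachW hu) => {t hu}.
elim: u a s hs => [|u IHu] a s //=; rewrite -iterS iterSr.
rewrite {2}/pstep /=.
case E: (trans a (scans s)).1 => [a'|] hs.
  rewrite -addn1 addnC; apply: reachD (IHu _ _ hs); apply: reach1.
  by rewrite /pstep /= gE /= E.
have {hs} <- : (fun k => operate (s k) ((trans a (scans s)).2 k)) = s'.
  have fixu v s1 : iter v (@pstep p) (None, s1) = (None, s1).
    by elim: v => //= v ->.
  by move: hs; rewrite fixu => -[].
exists 1 => //=.
by rewrite /pstep /= gE /= E.
Qed.

(** Since x + y <= 2xy for positive x and y, and 2 <= B, adding two times costs one factor B besides
    their product. A loop pays two such factors, one for the test in each round and one for the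
    final test. *)
Fixpoint cost (p : prog) : nat :=
  match p with
  | Act _ => 0
  | Seq p q => (cost p + cost q).+1
  | If _ p q => (cost p + cost q).+1
  | Loop e _ p => (e + cost p).+2
  end.

Variable B : nat.
Hypothesis B_gt1 : 1 < B.

Definition run (p : prog) (s s' : store) : Prop :=
  @reach p (B ^ cost p) (Some (start p), s) (None, s').

Lemma idleE (s : store) : (fun k => operate (s k) (idle k)) = s.
Proof.
apply: funext => k; rewrite /operate /idle /=.
by case: (s k) => p f /=; case: (0 < p).
Qed.

Lemma run_act f s :
  run (Act f) s (fun k => operate (s k) (f (scans s) k)).
Proof. by exists 1. Qed.

Lemma pow_gt0 e : 0 < B ^ e.
Proof. by rewrite expn_gt0; lia. Qed.

Lemma run_seq p q s1 s2 s3 : run p s1 s2 -> run q s2 s3 -> run (Seq p q) s1 s3.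
Proof.
move=> h1 h2; apply: (@reachW _ (B ^ cost p + B ^ cost q)).
  rewrite /= expnS expnD; have := pow_gt0 (cost p); have := pow_gt0 (cost q).
  move: (B ^ cost p) (B ^ cost q) => x y y_gt0 x_gt0.
  have : x + y <= 2 * (x * y) by nia.
  by move/leq_trans; apply; rewrite leq_mul2r B_gt1 orbT.
apply: reachD.
  apply: (@reach_embed _ (Seq p q) inl (Some (inr (start q))) _ _ _ _ _ h1).
  by move=> a r /=; case: (trans a r).1.
apply: (@reach_embed _ (Seq p q) inr None _ _ _ _ _ h2).
by move=> a r /=; case: (trans a r).1.
Qed.

Lemma run_if b p q s s' :
  run (if b (scans s) then p else q) s s' -> run (If b p q) s s'.
Proof.
move=> h; apply: (@reachW _ (1 + B ^ (cost p + cost q))).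
  rewrite /= expnS; have := pow_gt0 (cost p + cost q).
  by move: (B ^ _) => x x_gt0; nia.
apply: reachD.
  by apply: reach1; rewrite /pstep /= idleE.
move: h; case: (b (scans s)) => h.
  apply: (@reachW _ (B ^ cost p)); first by rewrite leq_exp2l // leq_addr.
  apply: (@reach_embed _ (If b p q) (Some \o inl) None _ _ _ _ _ h).
  by move=> a r /=; case: (trans a r).1.
apply: (@reachW _ (B ^ cost q)); first by rewrite leq_exp2l // leq_addl.
apply: (@reach_embed _ (If b p q) (Some \o inr) None _ _ _ _ _ h).
by move=> a r /=; case: (trans a r).1.
Qed.

Lemma run_loop_inv e (b : reading -> bool) p (I : nat -> store -> Prop) j s :
  j <= B ^ e -> I 0 s ->
  (forall i s, i < j -> I i s ->
     b (scans s) /\ exists2 s', run p s s' & I i.+1 s') ->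
  (forall s, I j s -> ~~ b (scans s)) ->
  exists2 s', run (Loop e b p) s s' & I j s'.
Proof.
move=> hj I0 IS Ij.
suff main k i s0 : i + k = j -> I i s0 -> exists2 s',
    @reach (Loop e b p) (k * (1 + B ^ cost p) + 1) (Some None, s0) (None, s')
    & I j s'.
  have [s' hr Is'] := main j 0 s (add0n j) I0; exists s' => //.
  apply: reachW hr; rewrite /= !expnS expnD.
  have := pow_gt0 e; have := pow_gt0 (cost p).
  move: (B ^ cost p) (B ^ e) hj => x y hj x_gt0 y_gt0.
  have : j * (1 + x) + 1 <= 2 * (2 * (y * x)).
    have : j * (1 + x) <= y * (1 + x) by rewrite leq_mul2r hj orbT.
    by nia.
  by move/leq_trans; apply; rewrite !leq_mul // leq_mul2r B_gt1 orbT.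
elim: k i s0 => [|k IHk] i s0.
  rewrite addn0 => -> Is0; exists s0 => //.
  by apply: reach1; rewrite /pstep /= (negbTE (Ij _ Is0)) idleE.
move=> ik Is0; have i_lt : i < j by lia.
have [bs [s1 rs1 Is1]] := IS _ _ i_lt Is0.
have [|s' hr Is'] := IHk i.+1 s1 _ Is1; first by lia.
exists s' => //; rewrite mulSn -addnA; apply: reachD hr.
apply: reachD; first by apply: reach1; rewrite /pstep /= bs idleE.
apply: (@reach_embed _ (Loop e b p) Some (Some None) _ _ _ _ _ rs1).
by move=> a r /=; case: (trans a r).1.
Qed.

Lemma run_loop e (b : reading -> bool) p (F : nat -> store) j :
  j <= B ^ e ->
  (forall i, i < j -> b (scans (F i)) /\ run p (F i) (F i.+1)) ->
  ~~ b (scans (F j)) ->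
  run (Loop e b p) (F 0) (F j).
Proof.
move=> hj hF hb.
have [|||s' r <-] // := @run_loop_inv e b p (fun i s => s = F i) j (F 0) hj.
- by move=> i s lt ->; have [bF rF] := hF _ lt; split=> //; exists (F i.+1).
- by move=> s ->.
Qed.

End Language.

Arguments idle {sigma K}.

(** * Compilation of structured programs to Turing machines *)

Section Compile.
Variables (sigma : finType) (K : finType).
Notation names := (option K).
Notation sym := (option (sigma + unit)).

Variables (p : prog sigma names) (acc : reading sigma names -> bool).

Definition slot (k : names) : 'I_#|K|.+1 :=
  if k is Some k then lift ord0 (enum_rank k) else ord0.
Definition unslot (i : 'I_#|K|.+1) : names := omap enum_val (unlift ord0 i).

Lemma slotK : cancel slot unslot.
Proof.
by case=> [k|]; rewrite /unslot /slot ?liftK ?unlift_none //= enum_rankK.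
Qed.

Definition mark : sym := Some (inr tt).
Definition emit (c : option sigma) : sym := omap inl c.
Definition recv (a : sym) : option (option sigma) :=
  match a with
  | None => Some None
  | Some (inl x) => Some (Some x)
  | Some (inr _) => None
  end.

(* In phase 0 the head of the input tape steps to the left of the input and the
   other tapes receive their mark; in phase 1 the input tape is marked. *)
Inductive phase := Phase0 | Phase1 | Running of option (st p) | Halted of bool.

Definition phase_code (x : phase) : bool + (option (st p) + bool) :=
  match x with
  | Phase0 => inl false
  | Phase1 => inl true
  | Running a => inr (inl a)
  | Halted b => inr (inr b)
  end.
Definition phase_decode (x : bool + (option (st p) + bool)) : phase :=
  match x with
  | inl false => Phase0
  | inl true => Phase1
  | inr (inl a) => Running a
  | inr (inr b) => Halted b
  end.
Lemma phase_codeK : cancel phase_code phase_decode.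
Proof. by case. Qed.
HB.instance Definition _ := Equality.copy phase (can_type phase_codeK).
HB.instance Definition _ := Choice.copy phase (can_type phase_codeK).
HB.instance Definition _ := Countable.copy phase (can_type phase_codeK).
HB.instance Definition _ := Finite.copy phase (can_type phase_codeK).

(** On the mark writing is suppressed and a left move becomes a stay. This mirrors [operate], where
    position 0 is its own predecessor and is never written. *)
Definition perform (a : sym) (o : option (option sigma) * direction) :
    sym * direction :=
  if recv a is None then (a, if o.2 is MoveLeft then Stay else o.2)
  else (if o.1 is Some c then emit c else a, o.2).

Definition mtrans (q : phase) (h : {ffun 'I_#|K|.+1 -> sym}) :
    phase * ('I_#|K|.+1 -> sym * direction) :=
  let r : reading sigma names := fun k => recv (h (slot k)) in
  match q with
  | Phase0 => (Phase1, fun i => if i == ord0 then (h i, MoveLeft) else (mark, Stay))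
  | Phase1 => (Running (Some (start p)), fun i => (mark, Stay))
  | Running (Some a) =>
      let x := trans a r in
      (Running x.1, fun i => perform (h i) (x.2 (unslot i)))
  | Running None => (Halted (acc r), fun i => (h i, Stay))
  | Halted b => (Halted b, fun i => (h i, Stay))
  end.

Definition compiled : machine sigma :=
  @Machine sigma #|K| phase unit Phase0
    (fun q => if q is Halted b then Some b else None) mtrans.

(** The list starts at the mark, so the half of the two-way tape left of it never appears; the
    default [None] of [nth] accounts for the blanks on the right. *)
Definition represents (x : track sigma) (t : tape compiled) : Prop :=
  size (tp_left t) = x.1 /\
  forall i, nth None (rev (tp_left t) ++ tp_head t :: tp_right t) i =
    if i is 0 then mark else emit (x.2 i).

Lemma represents_scan x t : represents x t -> recv (tp_head t) = scan x.
Proof.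
case: x t => [n f] [l h r] [/= <- E]; have := E (size l).
rewrite nth_cat size_rev ltnn subnn /= /scan /= => ->.
by case: (size l) => //= n'; case: (f n'.+1).
Qed.

Lemma represents_operate x t o : represents x t ->
  represents (operate x o)
    (tape_move (perform (tp_head t) o).2
       (@tape_write sigma compiled (perform (tp_head t) o).1 t)).
Proof.
move=> xt; have sc := represents_scan xt.
rewrite /perform sc.
case: x xt sc => [n f]; case: t => [l h r]; case: o => [w d] [/= sl E] sc.
have [n0|n_gt0] := posnP n.
  have l0 : l = [::] by apply: size0nil; rewrite sl.
  rewrite /scan /= n0 /operate /= {sc}; subst l n.
  case: d; split=> //= i; rewrite -E //=; case: i => [|i] //=.
  by case: r {E} => [|b r] //=; case: i => [|[|i]].
case: n n_gt0 sl E sc => // n _ sl E sc.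
rewrite /scan /operate /=.
set h' := (if w is Some c then emit c else h).
set f' := (if w is Some c then put f n.+1 c else f).
have E' i : nth None (rev l ++ h' :: r) i = (if i is 0 then mark else emit (f' i)).
  have := E i; rewrite !nth_cat size_rev sl.
  case: ltngtP => [lt|gt|->].
  - case: i lt => [|i] lt -> //; rewrite /f'; case: w {h'} @f' => // c.
    by rewrite /put ifN //; lia.
  - case: i gt => [|i] gt; first by lia.
    rewrite -(subnKC gt) addSn subSn ?leq_addr //= => ->.
    rewrite /f'; case: w {h'} @f' => // c; rewrite /put ifN //; lia.
  - rewrite subnn /= => hE; rewrite /h' /f'.
    by case: w {h' f'} => // c; rewrite /put eqxx.
case: d => /=; split=> //=.
- by rewrite size_behead sl.
- case: l sl {E} E' => //= a l _ E' i; rewrite -E' rev_cons -cats1 -catA /=.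
  by [].
- by rewrite sl.
- move=> i; rewrite -E' rev_cons -cats1 -catA /= !nth_cat.
  case: ltnP => // _; case: (i - _) => //= j.
  by case: r {E E'} => [|b r] //=; case: j => [|[|j]].
Qed.

Definition represented (s : store sigma names) (c : config compiled) : Prop :=
  forall k, represents (s k) (cf_tapes c (slot k)).

Lemma represented_step a s (c : config compiled) :
  cf_state c = Running (Some a) -> represented s c ->
  let x := pstep (Some a, s) in
  cf_state (tm_step c) = Running x.1 /\ represented x.2 (tm_step c).
Proof.
move=> ca sc /=.
have rE : (fun k => recv ([ffun i => tp_head (cf_tapes c i)] (slot k))) = scans s.
  by apply: funext => k; rewrite ffunE (represents_scan (sc k)).
rewrite /tm_step ca /= rE /pstep /=; split=> // k /=.
rewrite ffunE slotK; exact: represents_operate.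
Qed.

Lemma represented_iter t a s (c : config compiled) s' :
  cf_state c = Running (Some a) -> represented s c ->
  iter t (@pstep _ _ p) (Some a, s) = (None, s') ->
  exists2 t', t' <= t &
    cf_state (iter t' (@tm_step _ compiled) c) = Running None
    /\ represented s' (iter t' (@tm_step _ compiled) c).
Proof.
elim: t a s c => [|t IHt] a s c //= ca sc; rewrite -iterS iterSr.
have [] := represented_step ca sc.
case E : (pstep (Some a, s)) => [[a'|] s1] /= h1 h2 h.
  have [t' lt ht] := IHt _ _ _ h1 h2 h.
  by exists t'.+1 => //; rewrite iterSr.
exists 1 => //=.
suff <- : s1 = s' by [].
have fixu v : iter v (@pstep _ _ p) (None, s1) = (None, s1).
  by elim: v => //= v ->.
by move: h; rewrite fixu => -[].
Qed.

Definition initial_store (w : seq sigma) : store sigma names := fun k =>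
  (0, if k is Some _ then fun=> None else tape_of w).

Lemma compiled_outcome w t s' :
  iter t (@pstep _ _ p) (Some (start p), initial_store w) = (None, s') ->
  forall t', t + 3 <= t' -> tm_outcome compiled w t' = Some (acc (scans s')).
Proof.
move=> run_s' t' le_t.
set c2 := iter 2 (@tm_step _ compiled) (tm_init compiled w).
have [c2s c2r] : cf_state c2 = Running (Some (start p)) /\
    represented (initial_store w) c2.
  rewrite /c2 /= /tm_step /=; split=> // k; rewrite /represents /= ffunE /=.
  case: k => [k|] /=; first by rewrite /initial_store /=; split=> //; case=> [|[|i]].
  rewrite /initial_store /input_tape; case: w {run_s' c2} => [|x w] /=; split=> //.
    by case=> [|[|[|i]]] //=.
  case=> [|[|i]] //=.
  by elim: w i => [|y w IHw] [|i] //=.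
have [u le_u [us ur]] := represented_iter c2s c2r run_s'.
(* Two steps place the marks, u steps run the program, one evaluates [acc]; the halted configuration
   absorbs the rest. *)
have -> : t' = (t' - (u + 3)) + (1 + (u + 2)) by lia.
rewrite /tm_outcome iterD iterD [iter (u + 2) _ _]iterD -/c2 /=.
set c := iter u _ c2 in us ur *.
have h : cf_state (tm_step c) = Halted (acc (scans s')).
  rewrite /tm_step us /=; congr (Halted (acc _)).
  by apply: funext => k; rewrite ffunE (represents_scan (ur k)).
have fixc v : iter v (@tm_step _ compiled) (tm_step c) = tm_step c.
  by elim: v => //= v ->; rewrite {1}/tm_step h.
by rewrite fixc h.
Qed.

Lemma in_P_prog (L : seq sigma -> Prop) :
  (forall w, exists s',
     run (size w).+2 p (initial_store w) s' /\ (acc (scans s') <-> L w)) ->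
  in_P L.
Proof.
(* For a nonempty word |w| + 2 <= 3|w|; the additive [3 ^ cost p] serves the empty word, and the
   last 3 pays for the marks and for halting. *)
move=> H; exists compiled, (3 ^ cost p + 3), (cost p) => w.
have [s' [[t lt ht] hL]] := H w.
exists (acc (scans s')); split=> //.
apply: (compiled_outcome ht).
suff : (size w).+2 ^ cost p <= 3 ^ cost p * size w ^ cost p + 3 ^ cost p by nia.
have leX a b : a <= b -> a ^ cost p <= b ^ cost p.
  by case: (cost p) => // e le_ab; rewrite leq_exp2r.
case: (size w) => [|l]; first by rewrite (leq_trans (leX _ 3 _)) ?leq_addl.
by rewrite -expnMn (leq_trans (leX _ (3 * l.+1) _)) ?leq_addr //; lia.
Qed.

End Compile.

(** * Store updates and derived programs *)

Section Combinators.
Variables (sigma : finType) (K : finType).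
Notation store := (store sigma K).
Notation prog := (prog sigma K).
Notation reading := (reading sigma K).
Notation content := (content sigma).
Notation track := (track sigma).
Implicit Types (s : store) (k : K) (p : prog).

Definition upd s k (v : track) : store := fun k' => if k' == k then v else s k'.

Definition setp s k (q : nat) : store := upd s k (q, (s k).2).

Lemma upd_same s k v : upd s k v k = v.
Proof. by rewrite /upd eqxx. Qed.

Lemma upd_other s k v k' : k' != k -> upd s k v k' = s k'.
Proof. by rewrite /upd => /negbTE ->. Qed.

Lemma upd_id s k : upd s k (s k) = s.
Proof. by apply: funext => k'; rewrite /upd; case: eqP => [->|]. Qed.

Lemma upd_upd s k v v' : upd (upd s k v) k v' = upd s k v'.
Proof. by apply: funext => k'; rewrite /upd; case: eqP. Qed.

Lemma setp_same s k q : setp s k q k = (q, (s k).2).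
Proof. exact: upd_same. Qed.

Lemma setp_other s k q k' : k' != k -> setp s k q k' = s k'.
Proof. exact: upd_other. Qed.

Lemma setp_setp s k q q' : setp (setp s k q) k q' = setp s k q'.
Proof. by rewrite /setp upd_upd upd_same. Qed.

Lemma setp_id s k : setp s k (s k).1 = s.
Proof. by rewrite /setp -surjective_pairing upd_id. Qed.

Lemma setp_eq s k q f : s k = (q, f) -> setp s k q = s.
Proof. by move=> sk; rewrite /setp sk /= -sk upd_id. Qed.

Lemma updC s k k' v v' : k != k' ->
  upd (upd s k v) k' v' = upd (upd s k' v') k v.
Proof.
move=> kk'; apply: funext => x; rewrite /upd.
by case: (eqVneq x k') => // ->; rewrite eq_sym (negbTE kk').
Qed.

Lemma setpC s k k' q q' : k != k' ->
  setp (setp s k q) k' q' = setp (setp s k' q') k q.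
Proof.
by move=> kk'; rewrite /setp updC // !upd_other // eq_sym.
Qed.

Lemma setp_updC s k v k' q : k != k' ->
  setp (upd s k v) k' q = upd (setp s k' q) k v.
Proof. by move=> kk'; rewrite /setp updC // upd_other // eq_sym. Qed.

Lemma scan_isSome (x : track) : isSome (scan x) = (0 < x.1).
Proof. by case: x => [[|p] f]. Qed.

Definition act1 k (o : option (option sigma) * direction) : prog :=
  Act (fun _ k' => if k' == k then o else (None, Stay)).
Definition mv k d : prog := act1 k (None, d).
Definition wr k c : prog := act1 k (Some c, Stay).
(** Raising is idempotent. Lowering a flag needs no test: a left move does it, since the mark stops
    the head. *)
Definition raise k : prog := If (fun r => r k) (act1 k (None, Stay)) (mv k MoveRight).
Definition skip : prog := Act (fun _ => idle).

Definition each (T : Type) (l : seq T) (f : T -> prog) : prog :=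
  foldr (fun x q => Seq (f x) q) skip l.

Definition rew e k : prog := Loop e (fun r => r k) (mv k MoveLeft).

(** The mark does not read as blank, so the head takes the positions 0, ..., B - 1 if the first
    blank is in cell B. This position is the loop variable; the body may read it but must leave it
    in place. *)
Definition for_ruler k p : prog :=
  Seq (Loop 1 (fun r => r k != Some None) (Seq p (mv k MoveRight))) (rew 1 k).

Variable B : nat.
Hypothesis B_gt1 : 1 < B.
Notation run := (run B).

Lemma run_act1 k o s : run (act1 k o) s (upd s k (operate (s k) o)).
Proof.
suff -> : upd s k (operate (s k) o) = fun k' =>
    operate (s k') (if k' == k then o else (None, Stay)) by exact: run_act.
apply: funext => k'; rewrite /upd; case: eqP => [->|_] //.
by rewrite /operate /=; case: (s k') => [[|q] f].
Qed.

Lemma run_mv k d s : run (mv k d) s (setp s k (shift d (s k).1)).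
Proof.
have := run_act1 k (None, d) s; rewrite /setp /operate /=.
by case: (s k) => [[|q] f].
Qed.

Lemma run_mv_to k d s q : shift d (s k).1 = q -> run (mv k d) s (setp s k q).
Proof. by move=> <-; exact: run_mv. Qed.

Lemma run_wr k c s q f : s k = (q.+1, f) ->
  run (wr k c) s (upd s k (q.+1, put f q.+1 c)).
Proof. by move=> sk; have := run_act1 k (Some c, Stay) s; rewrite /operate sk. Qed.

Lemma run_raise k s : (s k).1 <= 1 -> run (raise k) s (setp s k 1).
Proof.
move=> le; apply: run_if => //; rewrite /scans scan_isSome.
case: ltnP => h; have := run_mv k (if 0 < (s k).1 then Stay else MoveRight) s.
  by rewrite h /= (_ : (s k).1 = 1) //; lia.
by rewrite ltnNge h /= (_ : (s k).1 = 0) //; lia.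
Qed.

Lemma run_skip s : run skip s s.
Proof. by rewrite -{2}[s]idleE; exact: run_act. Qed.

Lemma run_each (T : Type) (l : seq T) (f : T -> prog) (F : seq T -> store) :
  (forall l1 x l2, l = l1 ++ x :: l2 -> run (f x) (F l1) (F (rcons l1 x))) ->
  run (each l f) (F [::]) (F l).
Proof.
move=> hF; suff main l2 l1 : l = l1 ++ l2 -> run (each l2 f) (F l1) (F l).
  exact: main.
elim: l2 l1 => [|x l2 IHl] l1 lE; first by rewrite lE cats0; exact: run_skip.
apply: run_seq (hF _ _ _ lE) _ => //.
by apply: IHl; rewrite lE cat_rcons.
Qed.

Lemma run_rew e k s : (s k).1 <= B ^ e -> run (rew e k) s (setp s k 0).
Proof.
set q := (s k).1 => le.
have -> : setp s k 0 = setp s k (q - q) by rewrite subnn.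
have {1}<- : setp s k (q - 0) = s by rewrite subn0 setp_id.
apply: (run_loop B_gt1 (F := fun i => setp s k (q - i))) => // [i lt|].
  split.
    have : 0 < q - i by lia.
    by rewrite /scans setp_same /scan /=; case: (q - i).
  have := run_mv k MoveLeft (setp s k (q - i)).
  by rewrite setp_same setp_setp /= subnS.
by rewrite /scans setp_same /scan /= subnn.
Qed.

Lemma run_for k p (f : content) (I : nat -> store -> Prop) s :
  (forall i, 0 < i < B -> f i) -> f B = None -> s k = (0, f) -> I 0 s ->
  (forall i s, i < B -> I i s -> s k = (i, f) ->
     exists s', [/\ run p s s', s' k = (i, f) & I i.+1 (upd s' k (i.+1, f))]) ->
  exists s', [/\ run (for_ruler k p) s (upd s' k (0, f)), s' k = (B, f) & I B s'].
Proof.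
move=> f1 f2 sk I0 IS.
have [||||s' hr [sk' IB]] := @run_loop_inv _ _ B B_gt1 1 (fun r => r k != Some None)
  (Seq p (mv k MoveRight)) (fun i s => s k = (i, f) /\ I i s) B s.
- by rewrite expn1.
- by [].
- move=> i s0 lt [s0k Is0]; split.
    rewrite /scans s0k /scan /=; case: i lt {s0k Is0} => // i lt.
    by have := f1 i.+1; rewrite lt /=; case: (f i.+1) => // /(_ isT).
  have [s1 [rs1 s1k Is1]] := IS _ _ lt Is0 s0k.
  exists (upd s1 k (i.+1, f)); last by rewrite upd_same.
  apply: run_seq => //; first exact: rs1.
  by have := run_mv k MoveRight s1; rewrite /setp s1k.
- by move=> s0 [s0k _]; rewrite /scans s0k /scan /= f2; case: (B) B_gt1.
exists s'; split=> //; apply: run_seq => //; first exact: hr.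
by have := @run_rew 1 k s'; rewrite /setp sk' /= expn1; apply.
Qed.

Lemma run_for_eq k p (f : content) (H : nat -> store) :
  (forall i, 0 < i < B -> f i) -> f B = None ->
  (forall i, i < B -> run p (upd (H i) k (i, f)) (upd (H i.+1) k (i, f))) ->
  run (for_ruler k p) (upd (H 0) k (0, f)) (upd (H B) k (0, f)).
Proof.
move=> f1 f2 hH.
have [||i _ lt -> _|s' [hr _ sE]] := @run_for k p f
  (fun i s => s = upd (H i) k (i, f)) (upd (H 0) k (0, f)) f1 f2; rewrite ?upd_same //.
  exists (upd (H i.+1) k (i, f)).
  by rewrite upd_same upd_upd; split=> //; apply: hH.
by move: hr; rewrite sE upd_upd.
Qed.

End Combinators.

Arguments mv {sigma K}.
Arguments raise {sigma K}.
Arguments skip {sigma K}.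
Arguments rew {sigma K}.

(** * Counts and exchanges *)

Section Counts.
Variable n : nat.

Definition ty := {ffun 'I_n -> bool}.
Definition digit := (ty * 'I_n)%type.

(* The pair [e] of the goods of type [e.1.1], owned by [e.1.2], and of type
   [e.2.1], owned by [e.2.2], that trade places. *)
Notation swap := (digit * digit)%type.
Definition swaps : seq swap := [seq e : swap <- enum {: swap} | e.1.2 != e.2.2].
Definition in1 (e : swap) : digit := (e.1.1, e.2.2).
Definition in2 (e : swap) : digit := (e.2.1, e.1.2).

Definition before (e : swap) (c : digit -> nat) : digit -> nat :=
  fun a => c a + (a == e.1) + (a == e.2) - (a == in1 e) - (a == in2 e).
(* The last two conditions keep the counts [before e c] below [B], so that no
   carry falsifies their address in the table. *)
Definition undoable (B : nat) (e : swap) (c : digit -> nat) : bool :=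
  [&& 0 < c (in1 e), 0 < c (in2 e), c e.1 < B.-1 & c e.2 < B.-1].

Fixpoint reached (B : nat) (c0 : digit -> nat) (T : nat) (c : digit -> nat) :=
  if T is T'.+1 then
    has (fun e => undoable B e c && reached B c0 T' (before e c)) swaps
  else [forall a, c a == c0 a].

Definition worth (c : digit -> nat) (i j : 'I_n) : nat :=
  \sum_(t : ty | t i) c (t, j).
Definition ef1_counts (c : digit -> nat) : bool :=
  [forall i, forall j, (i != j) ==> (worth c i j <= (worth c i i).+1)].

(** The additive form avoids the truncated subtraction of [before] and stays correct when both goods
    have the same type, where gains and losses cancel. *)
Definition linked (e : swap) (c c' : digit -> nat) : Prop :=
  forall a, c' a + (a == e.1) + (a == e.2) = c a + (a == in1 e) + (a == in2 e).

Lemma swap_neq (e : swap) : e.1.2 != e.2.2 ->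
  [/\ (e.1 == e.2) = false, (in1 e == in2 e) = false,
      (e.1 == in1 e) = false & (e.2 == in2 e) = false].
Proof.
case: e => [[t i] [t' j]] /= ij; rewrite /in1 /in2 /= !xpair_eqE.
by rewrite [j == i]eq_sym (negbTE ij) !andbF.
Qed.

Lemma swap_cross (e : swap) : (e.1 == in2 e) = (e.1.1 == e.2.1) /\
  (e.2 == in1 e) = (e.1.1 == e.2.1).
Proof.
case: e => [[t i] [t' j]]; rewrite /in1 /in2 /= !xpair_eqE !eqxx !andbT.
by rewrite eq_sym.
Qed.

Lemma before_linked B e c : e.1.2 != e.2.2 -> undoable B e c ->
  [/\ linked e (before e c) c, 0 < before e c e.1 & 0 < before e c e.2].
Proof.
move=> /swap_neq [h1 h2 h3 h4] /and4P[p1 p2 _ _].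
have [h5 h6] := swap_cross e.
split.
- move=> a; rewrite /before.
  have : (a == in1 e) + (a == in2 e) <= c a.
    have [->|n1] := eqVneq a (in1 e); first by rewrite h2 addn0.
    by have [->|//] := eqVneq a (in2 e); rewrite add0n.
  move: (nat_of_bool (a == e.1)) (nat_of_bool (a == e.2)) (nat_of_bool (a == in1 e))
    (nat_of_bool (a == in2 e)) (c a) => x1 x2 y1 y2 z.
  by lia.
(* For goods of one type [e.1] is [in2 e], the trade changes nothing there, and positivity is
   inherited from [c (in2 e)]. *)
- rewrite /before eqxx h1 h3; case: (eqVneq e.1 (in2 e)) => [E|_]; last by lia.
  by move: p2; rewrite -E; lia.
- rewrite /before eqxx h4; case: (eqVneq e.2 (in1 e)) => [E|_]; last by lia.
  by move: p1; rewrite -E; lia.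
Qed.

Lemma linked_before B e c c' : e.1.2 != e.2.2 -> linked e c c' ->
  0 < c e.1 -> 0 < c e.2 -> c' e.1 < B.-1 -> c' e.2 < B.-1 ->
  undoable B e c' /\ before e c' = c.
Proof.
move=> /swap_neq [h1 h2 h3 h4] lk p1 p2 b1 b2.
have [h5 h6] := swap_cross e.
split; last first.
  apply: funext => a; have := lk a; rewrite /before.
  by move: (nat_of_bool (a == e.1)) (nat_of_bool (a == e.2)) (nat_of_bool (a == in1 e))
    (nat_of_bool (a == in2 e)) (c a) (c' a) => *; lia.
rewrite /undoable b1 b2 !andbT.
have := lk (in1 e); have := lk (in2 e).
rewrite !eqxx h2 [in2 e == in1 e]eq_sym h2.
rewrite [in1 e == e.1]eq_sym h3 [in2 e == e.2]eq_sym h4.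
have [E|_] := eqVneq (in2 e) e.1; have [E'|_] := eqVneq (in1 e) e.2;
  rewrite ?E ?E'; lia.
Qed.

End Counts.

Arguments in1 {n}.
Arguments in2 {n}.
Arguments swaps {n}.

(** * Exchanges of concrete goods, and short sequences of them *)

Section Exchanges.
Variables (n m : nat) (tau : 'I_m -> ty n).
Notation bundles := (bundles n m).
Implicit Types A B C : bundles.

Definition counts A (a : digit n) : nat :=
  \sum_(g < m) ((g \in A a.2) && (tau g == a.1)).

Lemma counts_le A a : counts A a <= m.
Proof.
rewrite -[X in _ <= X]card_ord -sum1_card; apply: leq_sum => g _.
exact: leq_b1.
Qed.

Lemma counts_gt0P A a :
  reflect (exists2 g, g \in A a.2 & tau g = a.1) (0 < counts A a).
Proof.
rewrite lt0n sum_nat_eq0 negb_forall.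
apply: (iffP existsP) => [[g]|[g gA gt]].
  by rewrite eqb0 negbK => /andP[gA /eqP gt]; exists g.
by exists g; rewrite gA gt eqxx.
Qed.

Lemma allocP A : reflect
  ((forall g, exists i, g \in A i) /\
   (forall g i j, g \in A i -> g \in A j -> i = j)) (is_allocation A).
Proof.
apply: (iffP andP) => [[/eqP cov /forallP dis]|[cov dis]]; split.
- move=> g; have : g \in [set: 'I_m] by rewrite inE.
  by rewrite -cov => /bigcupP[i _ gi]; exists i.
- move=> g i j gi gj; apply/eqP; apply: contraT => ij.
  have /forallP /(_ j) := dis i; rewrite ij /= => /pred0P /(_ g).
  by rewrite /= gi gj.
- apply/eqP/setP => g; rewrite inE; have [i gi] := cov g.
  by apply/bigcupP; exists i.
- apply/forallP => i; apply/forallP => j; apply/implyP => ij.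
  apply/pred0P => g /=; apply/negP => /andP[gi gj].
  by rewrite (dis _ _ _ gi gj) eqxx in ij.
Qed.

Definition swapped A i j g g' : bundles :=
  [ffun k => if k == i then (g' |: A i) :\ g
             else if k == j then (g |: A j) :\ g' else A k].

Lemma exchangeP A B : reflect
  (exists i j g g', [/\ i != j, g \in A i, g' \in A j & B = swapped A i j g g'])
  (exchange A B).
Proof.
apply: (iffP existsP) => [[i]|[i [j [g [g' [ij gi gj ->]]]]]].
  move=> /existsP[j] /existsP[g] /andP[gi] /existsP[g'] /andP[gj].
  move=> /and4P[ij /eqP Bi /eqP Bj /forallP Bk].
  exists i, j, g, g'; split=> //; apply/ffunP => k; rewrite ffunE.
  case: eqVneq => [->|ki] //; case: eqVneq => [->|kj] //.
  by have := Bk k; rewrite ki kj /= => /eqP.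
exists i; apply/existsP; exists j; apply/existsP; exists g; rewrite gi /=.
apply/existsP; exists g'; rewrite gj /= ij !ffunE !eqxx.
rewrite [j == i]eq_sym (negbTE ij) eqxx /=; apply/forallP => k.
by rewrite ffunE; apply/implyP => /andP[/negbTE -> /negbTE ->].
Qed.

Section Swapped.
Variables (A : bundles) (i j : 'I_n) (g g' : 'I_m).
Hypotheses (aA : is_allocation A) (ij : i != j) (gi : g \in A i) (gj : g' \in A j).
Let B := swapped A i j g g'.

Lemma swapped_neq : g != g'.
Proof.
have /allocP [_ dis] := aA; apply: contra_neq ij => gg.
by apply: dis gi _; rewrite gg.
Qed.

(** Since every good has one owner, an exchange just renames the owners of [g] and [g']; this form
    treats all bundles alike. *)
Lemma mem_swapped x k : (x \in B k) =
  if x == g then k == j else if x == g' then k == i else x \in A k.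
Proof.
have /allocP [_ dis] := aA; have gg := swapped_neq.
have kE y l k' : y \in A l -> (y \in A k') = (k' == l).
  by move=> yl; apply/idP/eqP => [yk|-> //]; apply: dis yk yl.
rewrite /B ffunE; case: (eqVneq k i) => [->|ki].
  rewrite !inE; case: (eqVneq x g) => [->|_] /=; first by rewrite (negbTE ij).
  by case: eqVneq.
case: (eqVneq k j) => [->|kj].
  rewrite !inE; case: (eqVneq x g') => [->|_] /=.
    by rewrite eq_sym (negbTE gg).
  by case: eqVneq.
case: (eqVneq x g) => [->|_]; first by rewrite (kE _ _ _ gi) (negbTE ki).
by case: (eqVneq x g') => [->|_] //; rewrite (kE _ _ _ gj) (negbTE kj).
Qed.

Lemma swapped_alloc : is_allocation B.
Proof.
have /allocP [cov dis] := aA; apply/allocP; split=> [x|x k l].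
  case: (eqVneq x g) => [->|xg]; first by exists j; rewrite mem_swapped !eqxx.
  case: (eqVneq x g') => [->|xg'].
    by exists i; rewrite mem_swapped eq_sym (negbTE swapped_neq) !eqxx.
  by have [k xk] := cov x; exists k; rewrite mem_swapped (negbTE xg) (negbTE xg').
rewrite !mem_swapped; case: eqP => [_ /eqP -> /eqP -> //|_].
by case: eqP => [_ /eqP -> /eqP -> //|_]; apply: dis.
Qed.

Lemma swapped_card k : #|B k| = #|A k|.
Proof.
have /allocP [_ dis] := aA; have gg := swapped_neq.
have g'i : g' \notin A i.
  by apply: contra ij => g'i; apply/eqP; apply: dis g'i gj.
have g_j : g \notin A j.
  by apply: contra ij => g_j; apply/eqP; apply: dis gi g_j.
rewrite /B ffunE; case: (eqVneq k i) => [->|ki].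
  have := cardsD1 g (g' |: A i); rewrite cardsU1 g'i !inE gi orbT /=.
  by move/eqP; rewrite eqn_add2l => /eqP ->.
case: (eqVneq k j) => [->|//].
have := cardsD1 g' (g |: A j); rewrite cardsU1 g_j !inE gj orbT /=.
by move/eqP; rewrite eqn_add2l => /eqP ->.
Qed.

Lemma swapped_linked : linked ((tau g, i), (tau g', j)) (counts A) (counts B).
Proof.
have /allocP [_ dis] := aA; have gg := swapped_neq.
move=> [t k]; rewrite /in1 /in2 /counts /=.
(* Each indicator becomes a sum over the goods, so that the identity can be checked good by good;
   only [g] and [g'] contribute a change. *)
have eqE (x : 'I_m) (l : 'I_n) :
  ((t, k) == (tau x, l)) = \sum_(y < m) ((y == x) && ((tau y == t) && (k == l))) :> nat.
  rewrite (bigD1 x) //= eqxx big1 => [|y /negbTE -> //].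
  by rewrite addn0 xpair_eqE [t == _]eq_sym.
rewrite !eqE -!big_split /=; apply: eq_bigr => x _.
rewrite mem_swapped.
case: (eqVneq x g) => [->|xg].
  have -> : (g \in A k) = (k == i) by apply/idP/eqP => [gk|-> //]; apply: dis gk gi.
  rewrite (negbTE gg).
  by case: (tau g == t); case: (k == i); case: (k == j).
case: (eqVneq x g') => [->|xg'] //.
have -> : (g' \in A k) = (k == j) by apply/idP/eqP => [gk|-> //]; apply: dis gk gj.
by case: (tau g' == t); case: (k == i); case: (k == j).
Qed.

End Swapped.

Lemma exchange_alloc A B : is_allocation A -> exchange A B -> is_allocation B.
Proof.
by move=> aA /exchangeP[i [j [g [g' [ij gi gj ->]]]]]; apply: swapped_alloc.
Qed.

Lemma path_alloc A s : is_allocation A -> path (@exchange n m) A s ->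
  is_allocation (last A s).
Proof.
elim: s A => //= B s IHs A aA /andP[AB]; apply: IHs.
exact: exchange_alloc AB.
Qed.

(** Goods of equal type and owner are interchangeable: a positive count supplies a concrete good to
    trade, and [linked] determines the counts afterwards. Counts of allocations are at most m and
    [m.+1 < b], so the caps in [undoable] exclude no exchange. *)
Lemma reachedP b A T c : m.+1 < b -> is_allocation A ->
  reflect (exists s, [/\ size s = T, path (@exchange n m) A s
                       & counts (last A s) = c])
          (reached b (counts A) T c).
Proof.
move=> mb aA; elim: T c => [|T IHT] c /=.
  apply: (iffP forallP) => [cA|[s [/size0nil -> _ <-]] //].
  by exists [::]; split=> //; apply: funext => a; apply/esym/eqP.
apply: (iffP hasP) => [[e]|[s]].
  rewrite mem_filter => /andP[ee _] /andP[und /IHT[s [sT ps cs]]].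
  have [lk p1 p2] := before_linked ee und.
  have aC := path_alloc aA ps; set C := last A s in cs aC.
  move: p1 p2; rewrite -cs => /counts_gt0P[g gi gt] /counts_gt0P[g' gj gt'].
  exists (rcons s (swapped C e.1.2 e.2.2 g g')).
  rewrite size_rcons sT rcons_path ps last_rcons /=; split=> //.
    by apply/exchangeP; exists e.1.2, e.2.2, g, g'.
  have := swapped_linked aC ee gi gj; rewrite gt gt' -!surjective_pairing cs.
  move=> lk'; apply: funext => a; have := lk a.
  by rewrite -(lk' a) => /eqP; rewrite !eqn_add2r => /eqP.
case: (lastP s) => [|{}s D]; first by case.
rewrite size_rcons rcons_path last_rcons => -[[sT] /andP[ps]].
have aC := path_alloc aA ps; set C := last A s in aC *.
move=> /exchangeP[i [j [g [g' [ij gi gj DE]]]]] cD.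
set e : digit n * digit n := ((tau g, i), (tau g', j)).
exists e; first by rewrite mem_filter /= ij mem_enum.
have lk := swapped_linked aC ij gi gj; rewrite -DE -/e cD in lk.
have [||||und bc] // := linked_before (B := b) (ij : e.1.2 != e.2.2) lk.
- by apply/counts_gt0P; exists g.
- by apply/counts_gt0P; exists g'.
- by rewrite -cD; apply: leq_ltn_trans (counts_le D _) _; lia.
- by rewrite -cD; apply: leq_ltn_trans (counts_le D _) _; lia.
by rewrite und bc; apply/IHT; exists s.
Qed.

Definition misplaced A B : {set 'I_m} :=
  [set g | [forall i, ~~ ((g \in A i) && (g \in B i))]].

(** Besides being an allocation, this is all that [short_path] has to know about the end of a long
    path in order to replace that path. *)
Lemma path_card A s : is_allocation A -> path (@exchange n m) A s ->
  forall i, #|last A s i| = #|A i|.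
Proof.
elim: s A => //= C s IHs A aA /andP[AC ps] i.
rewrite (IHs _ (exchange_alloc aA AC) ps).
have /exchangeP[i' [j [g [g' [ij gi gj ->]]]]] := AC.
exact: swapped_card.
Qed.

(* As the bundles have the same sizes, a misplaced good of [A] can always be
   traded for another misplaced good. *)
Lemma short_path A B : is_allocation A -> is_allocation B ->
  (forall i, #|B i| = #|A i|) ->
  exists s, [/\ size s <= #|misplaced A B|, path (@exchange n m) A s
              & last A s = B].
Proof.
move: {2}#|misplaced A B| (leqnn #|misplaced A B|) => k.
elim: k A => [|k IHk] A hk aA aB cAB.
  have /allocP [_ disA] := aA; have /allocP [covB disB] := aB.
  have /allocP [covA _] := aA.
  exists [::]; split=> //=; apply/ffunP => i; apply/setP => g.
  have : g \notin misplaced A B.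
    by move: hk; rewrite leqn0 cards_eq0 => /eqP ->; rewrite inE.
  rewrite inE negb_forall => /existsP[l]; rewrite negbK => /andP[gA gB].
  apply/idP/idP => gi; first by rewrite (disB _ _ _ (_ : g \in B i) gB) ?(disA _ _ _ gi gA).
  by rewrite (disB _ _ _ gi gB).
have [M0|[g gM]] := set_0Vmem (misplaced A B).
  by apply: IHk => //; rewrite M0 cards0.
have /allocP [covA disA] := aA; have /allocP [covB disB] := aB.
have [i gi] := covA g; have [j gj] := covB g.
have gN l : ~~ ((g \in A l) && (g \in B l)).
  by move: gM; rewrite inE => /forallP.
have ij : i != j by apply: contraL gi => /eqP ->; have := gN j; rewrite gj andbT.
have gAj : g \notin A j by have := gN j; rewrite gj andbT.
(* [B j] contains [g] and [A j] does not; having equal sizes, [A j] cannot be a subset of [B j]. *)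
have [g' g'A g'B] : exists2 g', g' \in A j & g' \notin B j.
  apply/subsetPn; apply: contraNN gAj => sAB.
  have /eqP -> : A j == B j by rewrite eqEcard sAB cAB leqnn.
  exact: gj.
set C := swapped A i j g g'.
have aC : is_allocation C by apply: swapped_alloc.
have g'N : g' \in misplaced A B.
  rewrite inE; apply/forallP => l; apply/negP => /andP[lA lB].
  by move: g'B; rewrite (disA _ _ _ g'A lA) lB.
have sub : misplaced C B \subset misplaced A B :\ g.
  apply/subsetP => x; rewrite inE => /forallP xC.
  have xg : x != g.
    by apply/eqP => E; have := xC j; rewrite mem_swapped // E !eqxx gj.
  rewrite !inE xg /=; apply/forallP => l.
  case: (eqVneq x g') => [->|xg']; first by move: g'N; rewrite inE => /forallP.
  by have := xC l; rewrite mem_swapped // (negbTE xg) (negbTE xg').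
have lt : #|misplaced C B| < #|misplaced A B|.
  by rewrite [X in _ < X](cardsD1 g) gM ltnS subset_leq_card.
have [||s [ss ps ls]] := IHk C _ aC aB.
- by rewrite -ltnS; apply: leq_trans lt hk.
- by move=> l; rewrite cAB swapped_card.
exists (C :: s); split=> //=; first exact: leq_ltn_trans ss lt.
by rewrite ps andbT; apply/exchangeP; exists i, j, g, g'.
Qed.

End Exchanges.

(** * Yes-instances in terms of counts *)

Section Answer.
Local Open Scope ring_scope.
Import GRing.Theory Num.Theory Order.TTheory.
Variables (R : realType) (n m : nat).

Lemma reachable_inP (u : 'I_n -> 'I_m -> R) A T : reflect
  (exists s, [/\ size s = T, path (@exchange n m) A s & EF1 u (last A s)])
  (EF1_reachable_in u A T).
Proof.
apply: (iffP existsP) => [[s /andP[ps es]]|[s [/eqP sT ps es]]].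
  by exists s; rewrite size_tuple.
by exists (Tuple sT); rewrite /= ps es.
Qed.

Lemma yes_instanceP (I : instance R n m) : yes_instance I <->
  exists2 T, (T <= bound I)%N & EF1_reachable_in (utility I) (initial I) T.
Proof.
rewrite /yes_instance /optimal_exchanges; case: pselect => [ex|nex].
  case: ex_minnP => T hT minT; split=> [le|[T' le hT']]; first by exists T.
  exact: leq_trans (minT _ hT') le.
by split=> // -[T _ hT]; apply: nex; exists T.
Qed.

(** Both bounds are used: T' <= T keeps within the bound of the instance, T' <= m within the rows of
    the table. *)
Lemma reachable_short (u : 'I_n -> 'I_m -> R) A T : is_allocation A ->
  EF1_reachable_in u A T ->
  exists2 T', (T' <= minn T m)%N & EF1_reachable_in u A T'.
Proof.
move=> aA hT; case: (leqP T m) => [le|gt].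
  by exists T => //; rewrite leqnn.
have /reachable_inP [s [sT ps es]] := hT.
have [s' [ss' ps' ls']] :=
  short_path aA (path_alloc aA ps) (path_card aA ps).
exists (size s'); last by apply/reachable_inP; exists s'; rewrite ls'.
apply: leq_trans ss' _; rewrite -[X in (_ <= X)%N]card_ord.
exact: max_card.
Qed.

Definition type_of (u : 'I_n -> 'I_m -> R) (g : 'I_m) : ty n :=
  [ffun i => u i g == 1].

(** Removing a good lowers a binary utility by at most one, and by exactly one if agent i likes the
    good. If [A j] contains no liked good, i values it at 0 and any of its goods is a witness. *)
Lemma EF1_counts (u : 'I_n -> 'I_m -> R) A :
  (forall i g, u i g = 0 \/ u i g = 1) ->
  EF1 u A = ef1_counts (counts (type_of u) A).
Proof.
move=> u01.
pose V i (S : {set 'I_m}) : nat := (\sum_(g in S) (u i g == 1%R))%N.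
have VE i S : utility_of u i S = (V i S)%:R.
  rewrite /utility_of /V natr_sum; apply: eq_bigr => g _.
  by case: (u01 i g) => ->; rewrite ?eqxx // eq_sym oner_eq0.
have wE i j : worth (counts (type_of u) A) i j = V i (A j).
  rewrite /worth /counts /= exchange_big /= /V [RHS]big_mkcond /=.
  apply: eq_bigr => g _; case: (g \in A j) => /=; last by rewrite big1.
  case ug : (u i g == 1).
    rewrite (bigD1 (type_of u g)) /= ?ffunE // eqxx big1 // => t /andP[_].
    by rewrite eq_sym => /negbTE ->.
  rewrite big1 // => t ti; case: eqP => // E; move: ti.
  by rewrite -E ffunE ug.
apply: eq_forallb => i; apply: eq_forallb => j; congr (_ ==> _).
rewrite !wE /EF1_towards.
have VD g : g \in A j -> V i (A j) = ((u i g == 1%R) + V i (A j :\ g))%N.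
  move=> gj; rewrite /V (bigD1 g) //=; congr (_ + _)%N.
  by apply: eq_bigl => x; rewrite !inE andbC.
apply/idP/idP => [/orP[/eqP ->|/existsP[g /andP[gj]]]|le].
- by rewrite /V big_set0.
- by rewrite !VE ler_nat (VD g gj); case: (u i g == 1); lia.
have [->|[g0 g0j]] := set_0Vmem (A j); first by rewrite eqxx.
apply/orP; right.
have [/existsP[g /andP[gj ug]]|/existsPn none] :=
    boolP [exists g, (g \in A j) && (u i g == 1)].
  apply/existsP; exists g; rewrite gj /= !VE ler_nat.
  by move: le; rewrite (VD g gj) ug.
apply/existsP; exists g0; rewrite g0j /= !VE ler_nat.
rewrite [V i (A j :\ g0)]big1 // => g; rewrite !inE => /andP[_ gj].
by have := none g; rewrite gj /=; case: (u i g == 1).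
Qed.

Lemma yes_instance_counts (I : instance R n m) b N :
  binary_utilities I -> (m.+1 < b)%N -> (m <= N)%N ->
  let tau := type_of (utility I) in
  yes_instance I <-> exists T c,
    [/\ (T <= N)%N, (T <= bound I)%N, (forall a, c a < b)%N,
        reached b (counts tau (initial I)) T c & ef1_counts c].
Proof.
move=> u01 mb mN tau; have aA := initial_alloc I.
rewrite yes_instanceP; split=> [[T Tk /(reachable_short aA)]|].
  move=> [T' le /reachable_inP [s [sT' ps es]]].
  exists T', (counts tau (last (initial I) s)); split=> //.
  - by lia.
  - by lia.
  - by move=> a; have := counts_le tau (last (initial I) s) a; lia.
  - by apply/reachedP => //; exists s.
  - by rewrite -EF1_counts.
move=> [T [c [_ Tk _ /(reachedP _ _ _ mb aA) [s [sT ps <-]] ec]]].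
exists T => //; apply/reachable_inP; exists s; split=> //.
by rewrite EF1_counts.
Qed.

End Answer.

(** * Arithmetic on tapes *)

Section Tapes.
Variable n : nat.

(* [Row (false, i)] and [Row (true, i)] receive the utilities and the bundle of
   agent i, [Bt] the bound; [Main None] holds T and [Main (Some a)] the count a
   of the current table entry, [Scr] drives the moves of the head of the table
   [Tab]; [Za], [Zb], [Yc] are counters.  [Bit], [Fail], [Dead] and [Acc] are
   flags, up when the head is off the mark: the entry is reached, it is not EF1,
   T exceeds the bound, some EF1 entry within the bound was reached. *)
Inductive tname :=
| Row of bool * 'I_n
| Main of option (digit n)
| Scr of digit n
| Bt | Tab | Za | Zb | Yc | Bit | Fail | Dead | Acc.

Definition tname_code (k : tname) :
    (bool * 'I_n) + (option (digit n) + (digit n + 'I_9)) :=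
  match k with
  | Row x => inl x
  | Main x => inr (inl x)
  | Scr x => inr (inr (inl x))
  | Bt => inr (inr (inr (@Ordinal 9 0 isT)))
  | Tab => inr (inr (inr (@Ordinal 9 1 isT)))
  | Za => inr (inr (inr (@Ordinal 9 2 isT)))
  | Zb => inr (inr (inr (@Ordinal 9 3 isT)))
  | Yc => inr (inr (inr (@Ordinal 9 4 isT)))
  | Bit => inr (inr (inr (@Ordinal 9 5 isT)))
  | Fail => inr (inr (inr (@Ordinal 9 6 isT)))
  | Dead => inr (inr (inr (@Ordinal 9 7 isT)))
  | Acc => inr (inr (inr (@Ordinal 9 8 isT)))
  end.

Definition tname_decode
    (x : (bool * 'I_n) + (option (digit n) + (digit n + 'I_9))) : tname :=
  match x with
  | inl x => Row x
  | inr (inl x) => Main x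
  | inr (inr (inl x)) => Scr x
  | inr (inr (inr i)) => nth Acc [:: Bt; Tab; Za; Zb; Yc; Bit; Fail; Dead] i
  end.

Lemma tname_codeK : cancel tname_code tname_decode.
Proof. by case. Qed.

HB.instance Definition _ := Equality.copy tname (can_type tname_codeK).
HB.instance Definition _ := Choice.copy tname (can_type tname_codeK).
HB.instance Definition _ := Countable.copy tname (can_type tname_codeK).
HB.instance Definition _ := Finite.copy tname (can_type tname_codeK).

End Tapes.

Arguments Bt {n}.
Arguments Tab {n}.
Arguments Za {n}.
Arguments Zb {n}.
Arguments Yc {n}.
Arguments Bit {n}.
Arguments Fail {n}.
Arguments Dead {n}.
Arguments Acc {n}.

Notation letter := (option bool).
Notation lit := (Some (Some (Some true))).
Notation main a := (Some (Main (Some a))).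
Notation bits bs := (tape_of (map Some (bs : seq bool))).

(** * Moving the table head, testing EF1 and decrementing the bound *)

Section Arithmetic.
Variable n : nat.
Notation store := (store letter (option (tname n))).
Notation prog := (prog letter (option (tname n))).
Notation reading := (reading letter (option (tname n))).
Notation digit := (digit n).
Implicit Types (s : store) (a : digit) (k : tname n) (c : digit -> nat).

Variable B : nat.
Hypothesis B_gt1 : 1 < B.
Notation run := (@run letter (option (tname n)) B).

(** The mark in cell 0 identifies the count 0, and the letter [true] in cell B - 1 the largest
    count: these are the two comparisons that [undoable] requires. The other letters are mere
    filling. *)
Definition ruler : content letter := tape_of (rcons (nseq B.-2 None) (Some true)).

Lemma rulerE i : 0 < i -> ruler i =
  if i < B.-1 then Some None else if i == B.-1 then Some (Some true) else None.
Proof.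
case: i => // i _; rewrite /ruler /tape_of map_rcons nth_rcons size_map size_nseq.
have -> : (i.+1 == B.-1) = (i == B.-2) by lia.
have -> : (i.+1 < B.-1) = (i < B.-2) by lia.
by rewrite map_nseq nth_nseq; case: (i < _).
Qed.

Lemma ruler_full i : 0 < i < B -> ruler i.
Proof.
move=> hi; rewrite rulerE; last by lia.
by case: ltngtP => // gt; lia.
Qed.

Lemma ruler_end : ruler B = None.
Proof. by rewrite rulerE; [case: ltngtP => // h; lia | lia]. Qed.

Lemma scan_ruler i : i < B ->
  (isSome (scan (i, ruler)) = (0 < i)) * ((scan (i, ruler) != lit) = (i < B.-1)).
Proof.
rewrite /scan; case: i => [|i] lt; first by split=> //; rewrite ltn_predRL.
split=> //; rewrite -[_ == _]/(ruler i.+1 == _) rulerE //.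
by case: ltngtP => // h; lia.
Qed.

Definition ready s := forall a, s (Some (Scr a)) = (0, ruler).

Lemma ready_upd s k v : ready s -> (forall a, k <> Scr a) ->
  ready (upd s (Some k) v).
Proof.
move=> rs ka a; rewrite upd_other //; apply/eqP => -[E]; exact: (ka a).
Qed.

(** A place value is a power of B and does not fit on one ruler; nested loops realize it as a number
    of moves. The scratch rulers are separate from the main ones, whose heads hold the current
    counts. *)
Definition stride (ds : seq digit) (d : direction) : prog :=
  foldr (fun a q => for_ruler (Some (Scr a)) q) (mv (Some Tab) d) ds.

Lemma run_stride ds d s : uniq ds ->
  (forall a, a \in ds -> s (Some (Scr a)) = (0, ruler)) ->
  run (stride ds d) s
    (setp s (Some Tab) (iter (B ^ size ds) (shift d) (s (Some Tab)).1)).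
Proof.
elim: ds s => [|a ds IHds] s /=; first by move=> _ _; exact: run_mv.
move=> /andP[a_ds ds_uniq] rs.
set k := Some (Scr a); set t := Some Tab.
pose H i := setp s t (iter (i * B ^ size ds) (shift d) (s t).1).
have HE i : upd (H i) k (0, ruler) = H i.
  by rewrite -(rs a) ?mem_head // 
    -[s _](@setp_other _ _ s t (iter (i * B ^ size ds) (shift d) (s t).1)) // upd_id.
have := @run_for_eq _ _ B B_gt1 k (stride ds d) ruler H ruler_full ruler_end.
rewrite !HE /H /= setp_id -expnS; apply=> i lt.
have -> : upd (H i.+1) k (i, ruler) = setp (upd (H i) k (i, ruler)) t
    (iter (B ^ size ds) (shift d) (upd (H i) k (i, ruler) t).1).
  rewrite /H upd_other // setp_same /= mulSn iterD /setp.
  rewrite [upd (upd s t _) k _ t]upd_other // upd_same /=.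
  by rewrite [RHS]updC // upd_upd updC.
apply: IHds => // b b_ds.
have ab : Some (Scr b) != k.
  by apply: contraNneq a_ds => -[<-].
by rewrite upd_other // setp_other // rs // inE b_ds orbT.
Qed.

Lemma iter_shift d i p : iter i (shift d) p =
  match d with MoveLeft => p - i | Stay => p | MoveRight => p + i end.
Proof. by case: d; elim: i => [|i /= ->] //=; lia. Qed.

Definition digits : seq digit := enum {: digit}.
(** Positional notation in base B with the first element of [digits] most significant; [weight_top]
    is the place value of T, written in front of all counts. *)
Definition after a : seq digit := drop (index a digits).+1 digits.
Definition weight a : nat := B ^ size (after a).
Definition weight_top : nat := B ^ size digits.

Lemma digits_uniq : uniq digits.
Proof. exact: enum_uniq. Qed.

Lemma mem_digits a : a \in digits.
Proof. by rewrite mem_enum. Qed.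

Lemma run_stride_at ds d s q : uniq ds -> ready s ->
  run (stride ds d) (setp s (Some Tab) q)
    (setp s (Some Tab) (match d with MoveLeft => q - B ^ size ds
                        | Stay => q | MoveRight => q + B ^ size ds end)).
Proof.
move=> u rs; have := run_stride d u (s := setp s (Some Tab) q).
by rewrite iter_shift setp_setp setp_same; apply=> a _; rewrite setp_other.
Qed.

Lemma after_uniq a : uniq (after a).
Proof. exact: drop_uniq digits_uniq. Qed.

(** Visits the entry of [before e c] in the previous row and returns. On either way the moves to the
    right come first, so the head never meets the mark, where moves to the left would be lost. *)
Definition lookup (e : digit * digit) : prog :=
  Seq (stride (after e.1) MoveRight)
  (Seq (stride (after e.2) MoveRight)
  (Seq (stride (after (in1 e)) MoveLeft)
  (Seq (stride (after (in2 e)) MoveLeft)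
  (Seq (stride digits MoveLeft)
  (Seq (If (fun r => r (Some Tab) == lit) (raise (Some Bit)) skip)
  (Seq (stride digits MoveRight)
  (Seq (stride (after (in2 e)) MoveRight)
  (Seq (stride (after (in1 e)) MoveRight)
  (Seq (stride (after e.2) MoveLeft)
       (stride (after e.1) MoveLeft)))))))))).

Lemma run_lookup e s P f p (b : bool) : ready s ->
  s (Some Tab) = (P, f) -> (s (Some Bit)).1 = b ->
  P + weight e.1 + weight e.2 =
    p.+1 + weight (in1 e) + weight (in2 e) + weight_top ->
  run (lookup e) s (setp s (Some Bit) (b || (f p.+1 == Some (Some true)))).
Proof.
move=> rs sT sb PE; set s' := setp s (Some Bit) _.
have rs' : ready s' by apply: ready_upd.
have sE : setp s (Some Tab) P = s by apply: setp_eq sT.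
have sE' : setp s' (Some Tab) P = s'.
  by apply: (@setp_eq _ _ _ _ _ f); rewrite /s' setp_other.
rewrite -[X in run _ X _]sE -[X in run _ _ X]sE' {sE sE'}.
do 5 (apply: run_seq => //; [by apply: run_stride_at => //;
      (exact: after_uniq || exact: digits_uniq)|rewrite -/(weight _)]).
rewrite -/weight_top; set q := (X in setp s _ X).
have -> : q = p.+1.
  rewrite /q; lia.
apply: (@run_seq _ _ _ _ _ _ _ (setp s' (Some Tab) p.+1)) => //.
  apply: run_if => //; rewrite /scans setp_same /scan /= sT /=.
  rewrite -[_ == _]/(f p.+1 == _) /s'.
  case: eqP => _.
    rewrite orbT setpC //; apply: run_raise => //.
    by rewrite setp_other // sb leq_b1.
  rewrite orbF -sb setp_id; exact: run_skip.
do 4 (apply: run_seq => //; [by apply: run_stride_at => //;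
      (exact: after_uniq || exact: digits_uniq)|rewrite -/(weight _)]).
have := run_stride_at MoveLeft
  (p.+1 + weight_top + weight (in2 e) + weight (in1 e) - weight e.2)
  (after_uniq e.1) rs'.
by rewrite -/(weight _) (_ : _ - weight e.1 = P) //; lia.
Qed.

(* Adds the position of [main a] to that of [k], by way of [Yc] from which the
   position is restored. *)
Definition transfer a (k : option (tname n)) : prog :=
  Seq (Loop 1 (fun r => r (main a))
         (Seq (mv (main a) MoveLeft) (Seq (mv k MoveRight) (mv (Some Yc) MoveRight))))
      (Loop 1 (fun r => r (Some Yc))
         (Seq (mv (Some Yc) MoveLeft) (mv (main a) MoveRight))).

Lemma run_transfer a (k : option (tname n)) s q : k != main a -> k != Some Yc ->
  (s (main a)).1 = q -> q <= B -> (s (Some Yc)).1 = 0 ->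
  run (transfer a k) s (setp s k ((s k).1 + q)).
Proof.
move=> km ky sq le sy; set z := (s k).1.
have yk : Some Yc != k by rewrite eq_sym.
have mk : main a != k by rewrite eq_sym.
pose F y i x := setp (setp (setp s (Some Yc) y) k x) (main a) i.
have FM y x i : (F y i x (main a)).1 = i by rewrite /F setp_same.
have Fk y x i : (F y i x k).1 = x.
  by rewrite /F (setp_other _ _ km) setp_same.
have FY y x i : (F y i x (Some Yc)).1 = y.
  by rewrite /F setp_other // (setp_other _ _ yk) setp_same.
have stM y x i i' : setp (F y i x) (main a) i' = F y i' x by rewrite /F setp_setp.
have stk y x i x' : setp (F y i x) k x' = F y i x'.
  by rewrite /F setpC // setp_setp.
have stY y x i y' : setp (F y i x) (Some Yc) y' = F y' i x.
  by rewrite /F setpC // [setp (setp _ k _) _ _](setpC _ _ _ ky) setp_setp.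
have FE x : F 0 q x = setp s k x.
  rewrite /F -sy setp_id -sq; apply: (@setp_eq _ _ _ _ _ (s (main a)).2).
  by rewrite setp_other // -surjective_pairing.
have s0 : s = F 0 (q - 0) (z + 0).
  by rewrite subn0 addn0 FE setp_id.
rewrite {1}s0 -FE; apply: (@run_seq _ _ _ _ _ _ _ (F q (q - q) (z + q))) => //.
  apply: (run_loop B_gt1 (F := fun i => F i (q - i) (z + i))) => //.
  - move=> i lt; rewrite scan_isSome FM; split; first by lia.
    apply: (run_seq B_gt1 (run_mv _ _ _ _)).
    rewrite FM stM; apply: (run_seq B_gt1 (run_mv _ _ _ _)).
    rewrite Fk stk subnS addnS -[F i.+1 _ _](stY i); apply: run_mv_to.
    by rewrite FY.
  - by rewrite scan_isSome FM subnn.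
have -> : F q (q - q) (z + q) = F (q - 0) 0 (z + q) by rewrite subnn subn0.
have -> : F 0 q (z + q) = F (q - q) q (z + q) by rewrite subnn.
apply: (run_loop B_gt1 (F := fun i => F (q - i) i (z + q))) => //.
- move=> i lt; rewrite scan_isSome FY; split; first by lia.
  apply: (run_seq B_gt1 (run_mv _ _ _ _)).
  rewrite FY stY subnS -[F _ i.+1 _](stM _ _ i); apply: run_mv_to.
  by rewrite FM.
- by rewrite scan_isSome FY subnn.
Qed.

Definition types_of (i : 'I_n) : seq (ty n) := [seq t : ty n <- enum {: ty n} | t i].

Lemma worthE c i j : worth c i j = \sum_(t <- types_of i) c (t, j).
Proof.
rewrite /types_of big_filter /worth.
by rewrite big_enum_cond; apply: eq_bigl => t; rewrite inE.
Qed.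

(** The 2^n <= B^n types contribute at most B - 1 each. This is the source of the exponent [n.+1] of
    the loops in [check]. *)
Lemma worth_bound c i j : (forall a, c a < B) -> (worth c i j).+1 <= B ^ n.+1.
Proof.
move=> cB.
have h : worth c i j <= #|{: ty n}| * B.-1.
  rewrite -sum_nat_const /worth big_mkcond [X in _ <= X]big_mkcond /=.
  apply: leq_sum => t _.
  by case: ifP => // _; rewrite -ltnS (ltn_predK B_gt1); apply: cB.
have [tE Bn] : #|{: ty n}| = 2 ^ n /\ 2 ^ n <= B ^ n.
  rewrite card_ffun card_bool card_ord; split=> //.
  by case: (n) => // k; rewrite leq_exp2r.
have := pow_gt0 B_gt1 n; rewrite expnS; move: h Bn; rewrite tE.
move: (2 ^ n) (B ^ n) => x y h1 h2 y_gt0.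
apply: (@leq_ltn_trans (y * B.-1)); first by rewrite (leq_trans h1) // leq_mul2r h2 orbT.
by rewrite mulnC ltn_mul2r y_gt0; lia.
Qed.

Lemma run_transfers c (z : option (tname n)) j (ts : seq (ty n)) s :
  (forall a, (s (main a)).1 = c a) -> (forall a, c a < B) ->
  z != Some Yc -> (forall a, z != main a) -> (s (Some Yc)).1 = 0 ->
  run (each ts (fun t => transfer (t, j) z)) s
    (setp s z ((s z).1 + \sum_(t <- ts) c (t, j))).
Proof.
move=> sc cB zy zm sy.
pose F l := setp s z ((s z).1 + \sum_(t <- l) c (t, j)).
have {1}-> : s = F [::] by rewrite /F big_nil addn0 setp_id.
apply: (run_each B_gt1 (F := F)) => l1 t l2 _.
have := @run_transfer (t, j) z (F l1) (c (t, j)) (zm _) zy.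
have zm' a : main a != z by rewrite eq_sym.
have yz : Some Yc != z by rewrite eq_sym.
rewrite /F setp_setp setp_same !setp_other // sc sy => /(_ erefl (ltnW (cB _)) erefl).
by rewrite /= -cats1 big_cat big_seq1 addnA.
Qed.

(** [Zb] gets a head start of 1 for the good that EF1 allows to disregard. After both counters have
    been counted down together, [Za] is left off the mark precisely if i values [A j] at more than
    one above its own bundle. *)
Definition check (i j : 'I_n) : prog :=
  Seq (mv (Some Zb) MoveRight)
  (Seq (each (types_of i) (fun t => transfer (t, i) (Some Zb)))
  (Seq (each (types_of i) (fun t => transfer (t, j) (Some Za)))
  (Seq (Loop n.+1 (fun r => r (Some Za) && r (Some Zb))
          (Seq (mv (Some Za) MoveLeft) (mv (Some Zb) MoveLeft)))
  (Seq (If (fun r => r (Some Za)) (raise (Some Fail)) skip)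
  (Seq (rew n.+1 (Some Za)) (rew n.+1 (Some Zb))))))).

Definition still s := [/\ (s (Some Za)).1 = 0, (s (Some Zb)).1 = 0 & (s (Some Yc)).1 = 0].

Lemma run_check i j s c (b : bool) :
  (forall a, (s (main a)).1 = c a) -> (forall a, c a < B) ->
  still s -> (s (Some Fail)).1 = b ->
  run (check i j) s
    (setp s (Some Fail) (b || ((worth c i i).+1 < worth c i j))).
Proof.
move=> sc cB [sa sb sy] sF.
set u := worth c i i; set v := worth c i j.
have uB : u.+1 <= B ^ n.+1 := worth_bound i i cB.
have vB : v.+1 <= B ^ n.+1 := worth_bound i j cB.
pose F x y := setp (setp s (Some Za) x) (Some Zb) y.
have Fa x y : (F x y (Some Za)).1 = x by rewrite /F setp_other // setp_same.
have Fb x y : (F x y (Some Zb)).1 = y by rewrite /F setp_same.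
have sta x y x' : setp (F x y) (Some Za) x' = F x' y.
  by rewrite /F setpC // setp_setp.
have stb x y y' : setp (F x y) (Some Zb) y' = F x y' by rewrite /F setp_setp.
have Fc x y a : (F x y (main a)).1 = c a by rewrite /F 2?setp_other.
have Fy x y : (F x y (Some Yc)).1 = 0 by rewrite /F 2?setp_other.
have s0 : s = F 0 0 by rewrite /F -{1}sa setp_id -{1}sb setp_id.
rewrite {1}s0; apply: (run_seq B_gt1 (run_mv _ _ _ _)); rewrite Fb stb /=.
apply: (run_seq B_gt1 (run_transfers i (types_of i) (Fc _ _) cB _ _ (Fy _ _))) => //.
rewrite Fb stb -worthE -/u add1n.
apply: (run_seq B_gt1 (run_transfers j (types_of i) (Fc _ _) cB _ _ (Fy _ _))) => //.
rewrite Fa sta -worthE -/v add0n.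
apply: (@run_seq _ _ _ _ _ _ _ (F (v - u.+1) (u.+1 - v))) => //.
  have -> : F v u.+1 = F (v - 0) (u.+1 - 0) by rewrite !subn0.
  have -> : F (v - u.+1) (u.+1 - v) =
      F (v - minn v u.+1) (u.+1 - minn v u.+1) by congr F; lia.
  apply: (run_loop B_gt1 (F := fun i => F (v - i) (u.+1 - i))) => [|k lt|].
  - by lia.
  - rewrite !scan_isSome Fa Fb; split; first by lia.
    apply: (run_seq B_gt1 (run_mv _ _ _ _)); rewrite Fa sta !subnS -[F _ (_).-1](stb _ (u.+1 - k)).
    by apply: run_mv_to; rewrite Fb.
  - by rewrite !scan_isSome Fa Fb; lia.
set w := b || _.
have stF x y : setp (F x y) (Some Fail) w =
    setp (setp (setp s (Some Fail) w) (Some Za) x) (Some Zb) y.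
  by rewrite /F setpC // [setp (setp _ _ _) (Some Fail) _]setpC.
apply: (@run_seq _ _ _ _ _ _ _ (setp (F (v - u.+1) (u.+1 - v)) (Some Fail) w)) => //.
  have FF : (F (v - u.+1) (u.+1 - v) (Some Fail)).1 = b by rewrite /F 2?setp_other.
  apply: run_if => //; rewrite scan_isSome Fa /w subn_gt0; case: ltnP => _.
    by rewrite orbT; apply: run_raise => //; rewrite FF leq_b1.
  by rewrite orbF -FF setp_id; exact: run_skip.
rewrite stF.
apply: (@run_seq _ _ _ _ _ _ _
  (setp (setp (setp s (Some Fail) w) (Some Za) 0) (Some Zb) (u.+1 - v))) => //.
  have -> : setp (setp (setp s (Some Fail) w) (Some Za) 0) (Some Zb) (u.+1 - v) =
     setp (setp (setp (setp s (Some Fail) w) (Some Za) (v - u.+1)) (Some Zb)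
       (u.+1 - v)) (Some Za) 0.
    by rewrite [RHS]setpC // setp_setp.
  by apply: run_rew => //; rewrite setp_other // setp_same /=; lia.
have sE : setp s (Some Fail) w =
    setp (setp (setp (setp s (Some Fail) w) (Some Za) 0) (Some Zb) (u.+1 - v)) (Some Zb) 0.
  rewrite setp_setp [setp (setp _ _ _) (Some Za) _]setpC // [setp (setp _ _ _) (Some Zb) _]setpC //.
  by rewrite -[X in setp s (Some Za) X]sa setp_id -[X in setp s (Some Zb) X]sb setp_id.
by rewrite [X in run _ _ X]sE; apply: run_rew => //; rewrite setp_same /=; lia.
Qed.

Definition check_all : prog :=
  each [seq x : 'I_n * 'I_n <- enum {: 'I_n * 'I_n} | x.1 != x.2]
    (fun x => check x.1 x.2).

Lemma run_check_all s c :
  (forall a, (s (main a)).1 = c a) -> (forall a, c a < B) ->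
  still s -> (s (Some Fail)).1 = 0 ->
  run check_all s (setp s (Some Fail) (~~ ef1_counts c)).
Proof.
move=> sc cB st_s sF; rewrite /check_all; set l := filter _ _.
pose bad (x : 'I_n * 'I_n) := (worth c x.1 x.1).+1 < worth c x.1 x.2.
have -> : ef1_counts c = ~~ has bad l.
  apply/idP/hasPn => [/forallP h [i j]|h].
    rewrite mem_filter /= => /andP[ij _]; rewrite -leqNgt.
    by have /forallP /(_ j) := h i; rewrite ij.
  apply/forallP => i; apply/forallP => j; apply/implyP => ij.
  by have := h (i, j); rewrite mem_filter /= ij mem_enum -leqNgt; apply.
pose F l := setp s (Some Fail) (has bad l).
rewrite negbK -[setp _ _ _]/(F l) -{1}[s](_ : F [::] = s); last first.
  by rewrite /F /= -sF setp_id.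
apply: (run_each B_gt1) => l1 x l2 _.
have := @run_check x.1 x.2 (F l1) c (has bad l1).
rewrite /F setp_setp setp_same has_rcons orbC; exact.
Qed.

Fixpoint value (bs : seq bool) : nat :=
  if bs is b :: bs' then b + (value bs').*2 else 0.

Lemma bits_nth bs i : bits bs i.+1 = 
  if i < size bs then Some (Some (nth false bs i)) else None.
Proof.
rewrite /tape_of; case: ltnP => h; last by rewrite nth_default ?size_map.
by rewrite (nth_map None) ?size_map // (nth_map false).
Qed.

Lemma scan_bits bs i : scan (i.+1, bits bs) =
  Some (if i < size bs then Some (Some (nth false bs i)) else None).
Proof. by rewrite /scan /= -[LHS]/(Some (bits bs i.+1)) bits_nth. Qed.

Lemma put_bits bs i b : i <= size bs -> put (bits bs) i.+1 (Some (Some b)) =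
  bits (take i bs ++ b :: drop i.+1 bs).
Proof.
by move=> le; rewrite put_tape_of ?size_map // map_cat -map_take /= -map_drop.
Qed.

(** Borrowing from the least significant bit on: low zeros become ones, the first one becomes zero.
    The value 0 wraps around to all ones and raises [Dead]; as this flag is never lowered, later
    decrements do no harm. *)
Definition decrement : prog :=
  Seq (Loop 1 (fun r => r (Some Bt) == Some (Some (Some false)))
         (Seq (wr (Some Bt) (Some (Some true))) (mv (Some Bt) MoveRight)))
  (Seq (If (fun r => r (Some Bt) == lit)
           (wr (Some Bt) (Some (Some false))) (raise (Some Dead)))
  (Seq (rew 1 (Some Bt)) (mv (Some Bt) MoveRight))).

Lemma run_decrement s bs : s (Some Bt) = (1, bits bs) -> size bs < B ->
  (s (Some Dead)).1 <= 1 ->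
  exists bs' d, [/\ size bs' = size bs,
    run decrement s (upd (setp s (Some Dead) d) (Some Bt) (1, bits bs')) &
    if value bs == 0 then d = 1
    else d = (s (Some Dead)).1 /\ value bs = (value bs').+1].
Proof.
move=> sB lt sD.
have [j [r [bsE rE]]] : exists j r, bs = nseq j false ++ r /\
    (r = [::] \/ exists r', r = true :: r').
  elim: bs {sB lt} => [|[] bs [j [r [-> rE]]]]; first by exists 0, [::]; split=> //; left.
    by exists 0, (true :: nseq j false ++ r); split=> //; right; exists (nseq j false ++ r).
  by exists j.+1, r.
have lej : j <= size bs by rewrite bsE size_cat size_nseq leq_addr.
pose F i := upd s (Some Bt) (i.+1, bits (nseq i true ++ nseq (j - i) false ++ r)).
have s0 : s = F 0 by rewrite /F subn0 /= -bsE -sB upd_id.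
have scE : scans (F j) (Some Bt) = Some (if r is [::] then None else Some (Some true)).
  rewrite /scans /F upd_same scan_bits subnn !size_cat !size_nseq nth_cat size_nseq ltnn subnn.
  by case: rE => [->|[r' ->]] /=; rewrite ?add0n ?addn0 ?ltnn // addnS ltnS leq_addr.
have loop : run (Loop 1 (fun r => r (Some Bt) == Some (Some (Some false)))
         (Seq (wr (Some Bt) (Some (Some true))) (mv (Some Bt) MoveRight))) s (F j).
  rewrite {1}s0; apply: (run_loop B_gt1) => [|i lti|].
  - by rewrite expn1; lia.
  - split.
      rewrite /scans /F upd_same scan_bits !size_cat !size_nseq ifT; last by lia.
      by rewrite nth_cat size_nseq ltnn subnn nth_cat size_nseq subn_gt0 lti nth_nseq subn_gt0 lti.
    apply: run_seq => //; first by apply: run_wr; rewrite /F upd_same.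
    have -> : F i.+1 = setp (upd (F i) (Some Bt)
        (i.+1, bits (nseq i.+1 true ++ nseq (j - i.+1) false ++ r))) (Some Bt) i.+2.
      by rewrite /setp !upd_upd upd_same.
    rewrite put_bits; last by rewrite !size_cat !size_nseq; lia.
    rewrite take_size_cat ?size_nseq // drop_cat size_nseq.
    rewrite ltnNge leqnSn /= subSnn -[in nseq (j - i) _](@prednK (j - i)) ?subn_gt0 // /= drop0.
    have -> : nseq i true ++ (true :: nseq (j - i).-1 false ++ r) =
       true :: nseq i true ++ nseq (j - i.+1) false ++ r.
      rewrite subnS; move: (nseq (j - i).-1 false ++ r) => X.
      by elim: (i) => //= k ->.
    by apply: run_mv_to; rewrite upd_same.
  - by rewrite scE; case: (r).
have finish d bs' : size bs' = size bs ->
    run (Seq (rew 1 (Some Bt)) (mv (Some Bt) MoveRight))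
      (upd (setp s (Some Dead) d) (Some Bt) (j.+1, bits bs'))
      (upd (setp s (Some Dead) d) (Some Bt) (1, bits bs')).
  move=> _; apply: run_seq => //.
    by apply: run_rew => //; rewrite upd_same /= expn1; lia.
  have -> : upd (setp s (Some Dead) d) (Some Bt) (1, bits bs') =
    setp (setp (upd (setp s (Some Dead) d) (Some Bt) (j.+1, bits bs')) (Some Bt) 0) (Some Bt) 1.
    by rewrite setp_setp /setp !upd_upd upd_same.
  by apply: run_mv_to; rewrite setp_same.
case: rE => [r0|[r' rE]].
  exists (nseq j true), 1; split.
  - by rewrite bsE r0 cats0 !size_nseq.
  - apply: run_seq loop _ => //; apply: (@run_seq _ _ _ _ _ _ _
      (upd (setp s (Some Dead) 1) (Some Bt) (j.+1, bits (nseq j true)))) => //; last first.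
      by apply: finish; rewrite bsE r0 cats0 !size_nseq.
    apply: run_if => //; rewrite scE r0 /=.
    have -> : upd (setp s (Some Dead) 1) (Some Bt) (j.+1, bits (nseq j true)) =
        setp (F j) (Some Dead) 1.
      by rewrite /setp /F r0 subnn /= !cats0 updC // upd_other.
    by apply: run_raise => //; rewrite /F upd_other.
  - rewrite bsE r0 cats0 ifT //; by elim: (j) => //= k /eqP ->.
exists (nseq j true ++ false :: r'), (s (Some Dead)).1; split.
- by rewrite bsE rE !size_cat !size_nseq.
- apply: run_seq loop _ => //; apply: (@run_seq _ _ _ _ _ _ _
      (upd (setp s (Some Dead) (s (Some Dead)).1) (Some Bt)
        (j.+1, bits (nseq j true ++ false :: r')))) => //; last first.
    by apply: finish; rewrite bsE rE !size_cat !size_nseq.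
  apply: run_if => //; rewrite scE rE /= setp_id.
  have FB : F j (Some Bt) = (j.+1, bits (nseq j true ++ r)).
    by rewrite /F upd_same subnn.
  have := run_wr B (Some (Some false)) FB.
  rewrite put_bits ?size_cat ?size_nseq ?leq_addr // take_size_cat ?size_nseq //.
  rewrite drop_cat size_nseq ltnNge leqnSn /= subSnn {1}rE /= drop0.
  have FE v : upd (F j) (Some Bt) v = upd s (Some Bt) v by rewrite /F upd_upd.
  by rewrite FE.
rewrite bsE rE; case: eqP => [h|_].
  by exfalso; move: h; elim: (j) => //= k IHk; lia.
by split=> //; elim: (j) => //= k IHk; lia.
Qed.

End Arithmetic.

Arguments check_all {n}.
Arguments decrement {n}.

(** * Filling the table *)

Section Table.
Variable n : nat.
Notation store := (store letter (option (tname n))).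
Notation prog := (prog letter (option (tname n))).
Notation reading := (reading letter (option (tname n))).
Notation digit := (digit n).
Implicit Types (s : store) (a : digit) (c : digit -> nat).

Variable B : nat.
Hypothesis B_gt1 : 1 < B.
Notation run := (@run letter (option (tname n)) B).
Notation digits := (@digits n).
Notation weight := (@weight n B).
Notation top := (@weight_top n B).
Notation ruler := (ruler B).

Definition address c : nat := \sum_(a <- digits) c a * weight a.

Lemma after_cat l1 a l2 : digits = l1 ++ a :: l2 -> after a = l2.
Proof.
move=> dE; have := digits_uniq n; rewrite /after dE cat_uniq /=.
move=> /and3P[_ /norP[a1 _] _].
by rewrite index_cat (negbTE a1) /= eqxx addn0 -cat_rcons drop_size_cat // size_rcons.
Qed.

Lemma weight_cat l1 a l2 : digits = l1 ++ a :: l2 -> weight a = B ^ size l2.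
Proof. by move=> dE; rewrite /weight (after_cat dE). Qed.

Lemma sum_weight_lt c l1 l2 : (forall a, c a < B) -> digits = l1 ++ l2 ->
  \sum_(a <- l2) c a * weight a < B ^ size l2.
Proof.
move=> cB; elim: l2 l1 => [|a l2 IHl] l1 dE; first by rewrite big_nil.
rewrite big_cons (weight_cat dE) /= expnS.
have := IHl (rcons l1 a); rewrite cat_rcons => /(_ dE).
have := cB a; move: (\sum_(_ <- _) _) (B ^ _) => x y h1 h2.
have : (c a).+1 * y <= B * y by rewrite leq_mul2r h1 orbT.
by rewrite mulSn; lia.
Qed.

Lemma address_lt c : (forall a, c a < B) -> address c < top.
Proof. by move=> cB; apply: (@sum_weight_lt c [::]). Qed.

Lemma sum_weight_inj c c' l1 l2 : (forall a, c a < B) -> (forall a, c' a < B) ->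
  digits = l1 ++ l2 ->
  \sum_(a <- l2) c a * weight a = \sum_(a <- l2) c' a * weight a ->
  forall a, a \in l2 -> c a = c' a.
Proof.
move=> cB cB'; elim: l2 l1 => [|a l2 IHl] l1 dE //.
have dE' : digits = rcons l1 a ++ l2 by rewrite cat_rcons.
rewrite !big_cons (weight_cat dE) => E.
have lt := sum_weight_lt cB dE'; have lt' := sum_weight_lt cB' dE'.
have [E1 E2] : c a = c' a /\ \sum_(a <- l2) c a * weight a = \sum_(a <- l2) c' a * weight a.
  have pos : 0 < B ^ size l2 := pow_gt0 B_gt1 _.
  have := congr1 (modn^~ (B ^ size l2)) E; rewrite !modnMDl !modn_small // => E2.
  split=> //; move/eqP: E; rewrite E2 eqn_add2r eqn_mul2r => /orP[|/eqP //].
  by rewrite eqn0Ngt pos.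
move=> b; rewrite inE => /predU1P[-> //|]; exact: IHl dE' E2 b.
Qed.

Lemma address_inj T c T' c' : (forall a, c a < B) -> (forall a, c' a < B) ->
  T * top + address c = T' * top + address c' -> T = T' /\ c = c'.
Proof.
move=> cB cB' E; have lt := address_lt cB; have lt' := address_lt cB'.
have pos : 0 < top := pow_gt0 B_gt1 _.
have := congr1 (modn^~ top) E; rewrite !modnMDl !modn_small // => E2.
split.
  move/eqP: E; rewrite E2 eqn_add2r eqn_mul2r => /orP[|/eqP //].
  by rewrite eqn0Ngt pos.
apply: funext => a; apply: (@sum_weight_inj c c' [::] digits) => //.
exact: mem_digits.
Qed.

Lemma addressE c : address c = \sum_a c a * weight a.
Proof. by rewrite /address big_enum. Qed.

Lemma address_delta (b : digit) : \sum_(a : digit) (a == b) * weight a = weight b.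
Proof.
rewrite (bigD1 b) //= eqxx mul1n big1 ?addn0 // => a /negbTE ->.
by rewrite mul0n.
Qed.

(** The address is linear in the counts, so undoing [e] shifts it by the same offset at every
    entry. *)
Lemma address_linked e c c' : linked e c c' ->
  address c' + weight e.1 + weight e.2 =
  address c + weight (in1 e) + weight (in2 e).
Proof.
move=> lk; rewrite !addressE -!address_delta -!big_split /=.
by apply: eq_bigr => a _; rewrite -!mulnDl lk.
Qed.

Lemma before_lt e c : e \in swaps -> undoable B e c -> (forall a, c a < B) ->
  forall a, before e c a < B.
Proof.
rewrite mem_filter => /andP[/swap_neq [/negbT h1 _ _ _] _] /and4P[_ _ b1 b2] cB a.
apply: (@leq_ltn_trans (c a + (a == e.1) + (a == e.2))).
  by rewrite /before -subnDA leq_subr.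
have [->|n1] := eqVneq a e.1; first by rewrite (negbTE h1) addn0 addn1 -ltn_predRL.
have [->|n2] := eqVneq a e.2; first by rewrite addn0 addn1 -ltn_predRL.
by rewrite !addn0.
Qed.

Variables (c0 : digit -> nat) (bound : nat).

(* Before entry [q] is processed, the cells from [q] on hold only the seed at
   the initial counts. *)
Definition table_ok (q : nat) (f : content letter) : Prop :=
  forall T c, (forall a, c a < B) ->
    (f (T * top + address c).+1 == Some (Some true)) =
    if T * top + address c < q then reached B c0 T c
    else (T == 0) && [forall a, c a == c0 a].

Definition accepted (q : nat) : Prop :=
  exists T c, [/\ forall a, c a < B, T * top + address c < q, T <= bound,
                reached B c0 T c & ef1_counts c].

(** While [Dead] is down the counter holds the bound minus T. After the wrap-around its bits mean
    nothing, and [bound < T] is all that is kept. *)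
Definition clock T s : Prop := exists bs,
  [/\ s (Some Bt) = (1, bits bs), size bs < B, (s (Some Dead)).1 <= 1 &
   if (s (Some Dead)).1 == 0 then value bs + T = bound else bound < T].

(** T is not computed from q: at the end of a row q already points to the next one while the clock
    has not ticked yet. *)
Definition inv T q s : Prop :=
  [/\ ready B s, still s, (s (Some Bit)).1 = 0 /\ (s (Some Fail)).1 = 0,
   exists f, s (Some Tab) = (q.+1, f) /\ table_ok q f &
   clock T s /\ ((s (Some Acc)).1 <= 1 /\ ((s (Some Acc)).1 = 1 <-> accepted q))].

Lemma inv_main T q s x v : inv T q s -> inv T q (upd s (Some (Main x)) v).
Proof.
move=> [rs [sa sb sy] [s1 s2] s3 [s4 s5]]; split.
- exact: ready_upd.
- by split; rewrite upd_other.
- by split; rewrite upd_other.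
- by rewrite upd_other.
- by rewrite /clock !upd_other.
Qed.

Lemma table_ok_step T c q f (b : bool) : (forall a, c a < B) ->
  q = T * top + address c -> reached B c0 T c = b -> table_ok q f ->
  table_ok q.+1 (if b then put f q.+1 (Some (Some true)) else f).
Proof.
move=> cB qE rb ok T' c' cB'; have okT := ok T' _ cB'.
have [E|ne] := eqVneq (T' * top + address c') q.
  have [TE cE] : T' = T /\ c' = c by apply: address_inj => //; rewrite E.
  rewrite E ltnSn TE cE rb; case: b rb => rb; first by rewrite /put eqxx.
  (* An entry that is not reached keeps its old cell. This cell holds no seed, since the seed is the
     entry reached with T = 0. *)
  move: okT; rewrite E ltnn TE cE => ->.
  by case: (T) rb => //= ->.
rewrite ltnS leq_eqVlt (negbTE ne) /= -okT; case: b {rb} => //.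
by rewrite /put eqSS (negbTE ne).
Qed.

(** [undoable] as seen by the heads: off the mark means positive, not on the letter [true] means
    below B - 1. *)
Definition may_undo (e : digit * digit) (r : reading) : bool :=
  [&& isSome (r (main (in1 e))), isSome (r (main (in2 e))),
      r (main e.1) != lit & r (main e.2) != lit].

Definition pull : prog :=
  each swaps (fun e => If (may_undo e) (lookup e) skip).

(** The first test picks up the seed. Row 0 is exempt from [pull], as no row precedes it. The two
    flags are reset for the next entry. *)
Definition cell : prog :=
  Seq (If (fun r => r (Some Tab) == lit) (raise (Some Bit)) skip)
  (Seq (If (fun r => r (Some (Main None))) pull skip)
  (Seq (If (fun r => r (Some Bit))
     (Seq (wr (Some Tab) (Some (Some true)))
     (Seq check_all
     (Seq (If (fun r => ~~ r (Some Fail) && ~~ r (Some Dead)) (raise (Some Acc)) skip)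
          (mv (Some Fail) MoveLeft)))) skip)
  (Seq (mv (Some Bit) MoveLeft) (mv (Some Tab) MoveRight)))).

Lemma run_pull T c q f s (b : bool) : ready B s ->
  s (Some Tab) = (q.+1, f) -> table_ok q f -> (s (Some Bit)).1 = b ->
  (forall a, s (main a) = (c a, ruler)) -> (forall a, c a < B) ->
  q = T.+1 * top + address c ->
  run pull s (setp s (Some Bit) (b || reached B c0 T.+1 c)).
Proof.
move=> rs sT ok sb sm cB qE.
pose P e := undoable B e c && reached B c0 T (before e c).
rewrite -[reached _ _ _ _]/(has P swaps).
have memS (e : digit * digit) : e \in swaps -> e.1.2 != e.2.2 by rewrite mem_filter => /andP[].
pose F l := setp s (Some Bit) (b || has P l).
rewrite -[setp _ _ _]/(F swaps) -{1}[s](_ : F [::] = s); last first.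
  by rewrite /F /= orbF -sb setp_id.
apply: (run_each B_gt1) => l1 e l2 lE.
have e_swaps : e \in swaps by rewrite lE mem_cat mem_head orbT.
apply: run_if => //.
have -> : may_undo e (scans (F l1)) = undoable B e c.
  rewrite /may_undo /scans /F !setp_other // !sm !scan_ruler //.
have FE : F (rcons l1 e) = setp (F l1) (Some Bit) ((b || has P l1) || P e).
  by rewrite /F setp_setp has_rcons -orbA [P e || _]orbC.
have FB : (F l1 (Some Bit)).1 = (b || has P l1) by rewrite /F setp_same.
case: ifP => und; last first.
  rewrite FE /P und orbF -FB setp_id; exact: run_skip.
rewrite FE.
have -> : P e = (f (T * top + address (before e c)).+1 == Some (Some true)).
  rewrite ok /P ?und /=; last exact: before_lt.
  (* The predecessor belongs to row T, which ends before entry q in row T + 1, so its cell is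
     final. *)
  rewrite ifT // qE mulSn.
  by have := address_lt (before_lt e_swaps und cB); lia.
apply: (@run_lookup _ _ B_gt1 e (F l1) q.+1) => //.
have [lk _ _] := before_linked (memS e e_swaps) und.
by have := address_linked lk; rewrite qE mulSn; lia.
Qed.

Lemma accepted_step T c q : (forall a, c a < B) -> q = T * top + address c ->
  accepted q.+1 <->
  accepted q \/ [/\ T <= bound, reached B c0 T c & ef1_counts c].
Proof.
move=> cB qE; split=> [[T' [c' [cB' lt Tb rc ec]]]|].
  move: lt; rewrite ltnS leq_eqVlt => /predU1P[E|lt]; last by left; exists T', c'.
  by have [<- <-] : T' = T /\ c' = c by [apply: address_inj; rewrite // E]; right.
case=> [[T' [c' [cB' lt Tb rc ec]]]|[Tb rc ec]].
  by exists T', c'; split=> //; rewrite ltnW.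
by exists T, c; split=> //; rewrite qE.
Qed.

Lemma run_cell T c q s : inv T q s ->
  (forall a, s (main a) = (c a, ruler)) -> s (Some (Main None)) = (T, ruler) ->
  (forall a, c a < B) -> q = T * top + address c ->
  exists s', [/\ run cell s s', inv T q.+1 s' &
                forall x, s' (Some (Main x)) = s (Some (Main x))].
Proof.
move=> [rs st_s [sb sF] [f [sT ok]] [clk [sA accE]]] sm sm0 cB qE.
have [bs [sBt szB sD dead]] := clk.
set b := reached B c0 T c.
set f' := if b then put f q.+1 (Some (Some true)) else f.
have alive : ((s (Some Dead)).1 == 0) = (T <= bound).
  by move: dead; case: eqP => _ h; [rewrite -h leq_addl | rewrite leqNgt h].
set w := b && (ef1_counts c && (T <= bound)).
set acc := if w then 1 else (s (Some Acc)).1.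
have main_other k v x : k != Some (Main x) -> upd s k v (Some (Main x)) = s (Some (Main x)).
  by move=> h; rewrite upd_other // eq_sym.
pose b1 := (T == 0) && [forall a, c a == c0 a].
have step1 : run (If (fun r => r (Some Tab) == lit) (raise (Some Bit)) skip) s
    (setp s (Some Bit) b1).
  apply: run_if => //; rewrite /scans sT /scan /=.
  have -> : (Some (f q.+1) == lit) = b1.
    by rewrite -[LHS]/(f q.+1 == _) qE ok // -qE ltnn.
  case: b1; first by apply: run_raise; rewrite // sb.
  by rewrite /= -[X in setp _ _ X]sb setp_id; exact: run_skip.
have step2 : run (If (fun r => r (Some (Main None))) pull skip)
    (setp s (Some Bit) b1) (setp s (Some Bit) b).
  apply: run_if => //; rewrite /scans setp_other // sm0 scan_isSome /=.
  (* In row 0 the seed is [reached] by definition; later rows contain no seed, so [pull] starts with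
     the flag down. *)
  rewrite /b /b1; case: (T) qE => [|T'] qE /=; first exact: run_skip.
  have := @run_pull T' c q f (setp s (Some Bit) 0) false.
  rewrite orFb setp_setp setp_same setp_other //; exact.
have step3 : run (If (fun r => r (Some Bit))
     (Seq (wr (Some Tab) (Some (Some true)))
     (Seq check_all
     (Seq (If (fun r => ~~ r (Some Fail) && ~~ r (Some Dead)) (raise (Some Acc)) skip)
          (mv (Some Fail) MoveLeft)))) skip)
    (setp s (Some Bit) b)
    (upd (setp (setp s (Some Bit) b) (Some Acc) acc) (Some Tab) (q.+1, f')).
  have tabE : setp s (Some Bit) b (Some Tab) = (q.+1, f) by rewrite setp_other.
  apply: run_if => //; rewrite /scans setp_same scan_isSome /= /acc /w /f'.
  case: (b) tabE => tabE; last first.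
    rewrite /= -(setp_other s 0 (_ : Some Acc != Some Bit)) // setp_id.
    by rewrite -tabE upd_id; exact: run_skip.
  set acc1 := if true && _ then _ else _.
  set s2 := setp s (Some Bit) true.
  set s3 := upd s2 (Some Tab) (q.+1, put f q.+1 (Some (Some true))).
  apply: (run_seq B_gt1 (run_wr B (Some (Some true)) tabE)); rewrite -/s2 -/s3.
  have s3F : (s3 (Some Fail)).1 = 0 by rewrite /s3 upd_other // /s2 setp_other.
  apply: (@run_seq _ _ _ _ _ _ _ (setp s3 (Some Fail) (~~ ef1_counts c))) => //.
    apply: run_check_all => // a.
    by rewrite -[c a]/(c a, ruler).1 -sm.
  set s4 := setp s3 (Some Fail) _.
  have s4E k : k != Some Fail -> k != Some Tab -> k != Some Bit -> s4 k = s k.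
    move=> kF kT kB; rewrite /s4 (setp_other _ _ kF) /s3 (upd_other _ _ kT).
    by rewrite /s2 (setp_other _ _ kB).
  apply: (@run_seq _ _ _ _ _ _ _ (setp s4 (Some Acc) acc1)) => //.
    apply: run_if => //; rewrite /scans !scan_isSome (s4E (Some Dead)) // /s4 setp_same /= -/s4.
    have -> : ~~ (0 < (~~ ef1_counts c : nat)) && ~~ (0 < (s (Some Dead)).1) =
        ef1_counts c && (T <= bound).
      by rewrite -alive eqn0Ngt; case: (ef1_counts c).
    rewrite /acc1 /=; case: ifP => _; first by apply: run_raise; rewrite // s4E.
    by rewrite -(s4E (Some Acc)) // setp_id; exact: run_skip.
  have -> : upd (setp s2 (Some Acc) acc1) (Some Tab) (q.+1, put f q.+1 (Some (Some true)))
    = setp (setp s4 (Some Acc) acc1) (Some Fail) 0.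
    rewrite /s4 setpC // setp_setp -[X in setp s3 _ X]s3F setp_id.
    by rewrite /s3 setp_updC.
  by apply: run_mv_to; rewrite setp_other // /s4 setp_same; case: (ef1_counts c).
pose s' := upd (setp s (Some Acc) acc) (Some Tab) (q.+2, f').
exists s'.
have s'E k : k != Some Acc -> k != Some Tab -> s' k = s k.
  by move=> kA kT; rewrite /s' (upd_other _ _ kT) (setp_other _ _ kA).
split; last by move=> x; rewrite s'E.
  apply: (run_seq B_gt1 step1); apply: (run_seq B_gt1 step2).
  apply: (run_seq B_gt1 step3).
  set s5 := upd _ _ _.
  have s5E k : k != Some Acc -> k != Some Tab -> k != Some Bit -> s5 k = s k.
    by move=> kA kT kB; rewrite /s5 (upd_other _ _ kT) (setp_other _ _ kA) (setp_other _ _ kB).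
  apply: (@run_seq _ _ _ _ _ _ _ (setp s5 (Some Bit) 0)) => //.
    apply: run_mv_to; rewrite /s5 upd_other // setp_other // setp_same.
    by case: (b).
  have -> : setp s5 (Some Bit) 0 = upd (setp s (Some Acc) acc) (Some Tab) (q.+1, f').
    rewrite /s5 setp_updC // setpC // setp_setp.
    by rewrite -[X in setp s (Some Bit) X]sb setp_id.
  set s6 := upd _ _ _.
  have -> : s' = setp s6 (Some Tab) q.+2 by rewrite /s6 /setp upd_upd upd_same.
  by apply: run_mv_to; rewrite /s6 upd_same.
split.
- by move=> a; rewrite s'E.
- by move: st_s => [? ? ?]; split; rewrite s'E.
- by rewrite !s'E // sb sF.
- exists f'; split; first by rewrite /s' upd_same.
  exact: (table_ok_step cB qE (erefl b)).
split; first by exists bs; rewrite !s'E.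
have -> : (s' (Some Acc)).1 = acc by rewrite /s' upd_other // setp_same.
split; first by rewrite /acc; case: (w).
rewrite (accepted_step cB qE) -accE /acc /w -/b.
split.
  case: ifP => [/and3P[bb eb Tb] _|_ ->]; last by left.
  by right.
case: ifP => // wF [] // [Tb bb eb].
by rewrite bb eb Tb in wF.
Qed.

Definition nest (ds : seq digit) (p : prog) : prog :=
  foldr (fun a q => for_ruler (main a) q) p ds.

(** The outer loops have fixed the digits outside [ds], and those in [ds] stand at 0. Round i of the
    loop over a sets this digit to i and so begins i blocks of B^|ds| entries further: lexicographic
    order is address order. *)
Lemma run_nest T l1 ds c q s : digits = l1 ++ ds -> inv T q s ->
  (forall a, s (main a) = (c a, ruler)) -> s (Some (Main None)) = (T, ruler) ->
  (forall a, c a < B) -> (forall a, a \in ds -> c a = 0) ->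
  q = T * top + address c ->
  exists s', [/\ run (nest ds cell) s s', inv T (q + B ^ size ds) s' &
                forall x, s' (Some (Main x)) = s (Some (Main x))].
Proof.
elim: ds l1 c q s => [|a ds IHds] l1 c q s dE is_ sm sm0 cB c0_ qE.
  have [s' [r' i' m']] := run_cell is_ sm sm0 cB qE.
  by exists s'; rewrite addn1.
have dE' : digits = rcons l1 a ++ ds by rewrite cat_rcons.
have a_ds : a \notin ds.
  by have := digits_uniq n; rewrite dE cat_uniq /= => /and3P[_ _ /andP[]].
have ca : c a = 0 by rewrite c0_ // mem_head.
pose I i s1 := inv T (q + i * B ^ size ds) s1 /\
  forall x, x != Some a -> s1 (Some (Main x)) = s (Some (Main x)).
have [||i s1 lt [is1 m1] s1a|s' [r' s'a [i' m']]] :=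
    @run_for _ _ B B_gt1 (main a) (nest ds cell) ruler I s
      (ruler_full B_gt1) (ruler_end B_gt1).
- by rewrite sm ca.
- by rewrite /I addn0.
- pose c1 b := if b == a then i else c b.
  have c1E b : c1 b * weight b = c b * weight b + i * ((b == a) * weight b).
    by rewrite /c1; case: eqP => [->|_]; rewrite ?ca ?mul1n ?mul0n ?muln0 ?addn0.
  have [|||||s2 [r2 i2 m2]] := IHds (rcons l1 a) c1 (q + i * B ^ size ds) s1 dE' is1.
  + move=> b; rewrite /c1; case: (eqVneq b a) => [-> //|ba].
    by rewrite m1 ?sm //; apply: contra_neq ba => -[].
  + by rewrite m1.
  + by move=> b; rewrite /c1; case: eqP.
  + move=> b b_ds; rewrite /c1 ifN ?c0_ // ?inE ?b_ds ?orbT //.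
    by apply: contraNneq a_ds => <-.
  + rewrite qE -addnA; congr (_ + _); rewrite !addressE (eq_bigr _ (fun b _ => c1E b)).
    by rewrite big_split -big_distrr /= address_delta (weight_cat dE).
  exists s2; rewrite m2; split=> //; split.
    by rewrite mulSn [_ + i * _]addnC addnA; exact: inv_main.
  by move=> x xa; rewrite upd_other ?m2 ?m1 //.
exists (upd s' (main a) (0, ruler)); split=> //; first by rewrite expnS; exact: inv_main.
move=> x; case: (eqVneq x (Some a)) => [->|xa]; first by rewrite upd_same sm ca.
by rewrite upd_other ?m' //; apply: contra_neq xa => -[].
Qed.

Lemma run_tick T q s : inv T q s ->
  exists s', [/\ run decrement s s', inv T.+1 q s' &
                forall x, s' (Some (Main x)) = s (Some (Main x))].
Proof.
move=> [rs st_s [sb sF] sT [[bs [sBt szB sD dead]] acc_s]].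
have [bs' [d [sz' r' dE]]] := run_decrement B_gt1 sBt szB sD.
exists (upd (setp s (Some Dead) d) (Some Bt) (1, bits bs')).
set s' := upd _ _ _ in r' *.
have s'E k : k != Some Bt -> k != Some Dead -> s' k = s k.
  by move=> kB kD; rewrite /s' (upd_other _ _ kB) (setp_other _ _ kD).
split=> //; split=> //.
split; last by rewrite s'E.
have s'D : (s' (Some Dead)).1 = d by rewrite /s' upd_other // setp_same.
exists bs'; rewrite s'D sz'; split=> //.
  by move: dE; case: ifP => _ => [->|[->]].
move: dE dead; case: (eqVneq (value bs) 0) => [-> ->|_ [-> ->]] /=; case: ifP => _; lia.
Qed.

Definition search : prog :=
  for_ruler (Some (Main None)) (Seq (nest digits cell) decrement).

Lemma run_search s : inv 0 0 s -> (forall x, s (Some (Main x)) = (0, ruler)) ->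
  exists2 s', run search s s' &
    0 < (s' (Some Acc)).1 <-> accepted (B * top).
Proof.
move=> is_ sm.
have addr0 : address (fun=> 0) = 0 by rewrite addressE big1.
pose I T s1 := inv T (T * top) s1 /\ forall a, s1 (main a) = (0, ruler).
have [||T s1 lt [is1 m1] s1T|s' [r' s'a [i' m']]] :=
    @run_for _ _ B B_gt1 (Some (Main None)) (Seq (nest digits cell) decrement) ruler I s
      (ruler_full B_gt1) (ruler_end B_gt1).
- exact: sm.
- by split.
- have [|||s2 [r2 i2 m2]] := @run_nest T [::] digits (fun=> 0) (T * top) s1 erefl is1 m1 s1T.
  + by move=> _; lia.
  + by [].
  + by rewrite addr0 addn0.
  have [s3 [r3 i3 m3]] := run_tick i2.
  exists s3; split; first exact: run_seq r2 r3.
    by rewrite m3 m2.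
  split; first by rewrite mulSn addnC; exact: inv_main.
  by move=> a; rewrite upd_other // m3 m2.
exists (upd s' (Some (Main None)) (0, ruler)) => //.
rewrite upd_other //; case: i' => _ _ _ _ [_ [le1 <-]].
by split; lia.
Qed.

Lemma acceptedP : accepted (B * top) <->
  exists T c, [/\ T <= B.-1, T <= bound, forall a, c a < B,
                 reached B c0 T c & ef1_counts c].
Proof.
split=> -[T [c [h1 h2 h3 h4 h5]]]; exists T, c; split=> //.
  have : T * top < B * top by lia.
  by rewrite ltn_mul2r => /andP[_]; lia.
have := address_lt h3.
have : T.+1 * top <= B * top by rewrite leq_mul2r; apply/orP; right; lia.
by rewrite mulSn; lia.
Qed.

End Table.

Arguments cell {n}.
Arguments search {n}.

(** * Encoded instances *)

Section Binary.
Implicit Types bs : seq bool.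

Lemma value_lt bs : value bs < 2 ^ size bs.
Proof.
elim: bs => //= b bs IH; rewrite expnS.
by move: (value bs) (2 ^ _) IH => v p; case: b => /=; lia.
Qed.

Lemma value_ge b bs : last b bs -> 2 ^ size bs <= value (b :: bs).
Proof.
elim: bs b => [|b' bs IH] b; first by case: b.
move=> h; have := IH b' h; rewrite -[value (b :: _)]/(b + (value (b' :: bs)).*2) expnS.
by move: (value _) (2 ^ _) => v p; lia.
Qed.

Lemma nth_value bs i : odd (value bs %/ 2 ^ i) = nth false bs i.
Proof.
elim: bs i => [|b bs IH] [|i]; rewrite /= ?div0n //.
  by rewrite expn0 divn1 oddD odd_double addbF oddb.
by rewrite expnS divnMA divn2 half_bit_double IH.
Qed.

(** [last true bs] excludes leading zeros; its default admits the empty expansion of 0. *)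
Lemma binary_value bs : last true bs -> binary (value bs) = bs.
Proof.
move=> h; have lt := value_lt bs.
have sE : up_log 2 (value bs).+1 = size bs.
  case: bs lt h => [|b bs] lt h //.
  by apply: up_log_eq => //; rewrite lt andbT ltnS value_ge.
apply: (@eq_from_nth _ false) => [|i]; rewrite /binary size_mkseq ?sE // => lti.
by rewrite nth_mkseq // nth_value.
Qed.

(** Reduces questions about [binary k] to words without leading zeros, where [binary_value]
    applies. *)
Lemma value_onto k : exists2 bs, last true bs & value bs = k.
Proof.
have [m] := ubnP k; elim: m k => // m IHm [|k] lt; first by exists [::].
have [|bs h vE] := IHm k.+1./2; first by lia.
exists (odd k.+1 :: bs); last by rewrite [LHS]/= vE; exact: odd_double_half.
case: bs h vE => //= _ vE.
by move: vE; case: (k) => //= k'; lia.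
Qed.

Lemma value_binary k : value (binary k) = k.
Proof. by have [bs h <-] := value_onto k; rewrite binary_value. Qed.

Lemma last_binary k : last true (binary k).
Proof. by have [bs h <-] := value_onto k; rewrite binary_value. Qed.

End Binary.

(** * Well-formed words and their membership in the language *)

Section Words.
Variables (R : realType) (n : nat).
Hypothesis n_gt0 : 0 < n.
Notation key := (bool * 'I_n)%type.
Implicit Types (rho : key -> seq bool) (ks : seq key) (w v : seq letter).

Definition block (bs : seq bool) : seq letter := rcons (map Some bs) None.
Definition flat ks rho : seq letter := flatten [seq block (rho k) | k <- ks].
Definition keys : seq key :=
  [seq (false, i) | i <- enum 'I_n] ++ [seq (true, i) | i <- enum 'I_n].

Lemma keys_uniq : uniq keys.
Proof.
have uE b : uniq [seq (b, i) | i <- enum 'I_n].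
  by rewrite map_inj_uniq ?enum_uniq // => i j [].
rewrite /keys cat_uniq !uE andbT /=; apply/hasPn => _ /mapP[i _ ->].
by apply/mapP => -[].
Qed.

Lemma mem_keys k : k \in keys.
Proof.
by case: k => [[] i]; rewrite mem_cat; apply/orP; [right | left];
  apply/mapP; exists i; rewrite ?mem_enum.
Qed.

Lemma flat_cons k ks rho : flat (k :: ks) rho = block (rho k) ++ flat ks rho.
Proof. by []. Qed.

(** No bit equals the separator, so the first separator shows where the block ends. *)
Lemma block_inj bs bs' v v' :
  block bs ++ v = block bs' ++ v' -> bs = bs' /\ v = v'.
Proof.
elim: bs bs' => [|b bs IH] [|b' bs'] //=; first by move=> [].
by move=> [-> /IH [-> ->]].
Qed.

Lemma flat_inj ks rho rho' v v' : flat ks rho ++ v = flat ks rho' ++ v' ->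
  {in ks, rho =1 rho'} /\ v = v'.
Proof.
elim: ks => [|k ks IH] //=; rewrite !flat_cons -!catA => /block_inj [E /IH [h ->]].
by split=> // k'; rewrite inE => /predU1P[->|/h].
Qed.

(** If the bound is the empty word, the last letter read is a separator and cannot be mistaken for a
    leading zero. *)
Lemma last_flat ks rho : last None (flat ks rho) = None.
Proof.
elim/last_ind: ks => // ks k _; rewrite /flat map_rcons flatten_rcons.
by rewrite last_cat last_rcons.
Qed.

Definition owned rho (g : nat) (i : 'I_n) : bool := nth false (rho (true, i)) g.
Definition liked rho (g : nat) : ty n := [ffun i => nth false (rho (false, i)) g].
Definition tally rho (m : nat) (a : digit n) : nat :=
  \sum_(g < m) (owned rho g a.2 && (liked rho g == a.1)).

Definition sole_owner rho g : bool := #|[pred i | owned rho g i]| == 1.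

(** The encodings of binary instances, described by conditions that can be checked column by
    column. *)
Definition good rho bs m : Prop :=
  [/\ 0 < m, forall k, size (rho k) = m, forall g, g < m -> sole_owner rho g
    & last true bs].

Definition rows_of m (I : instance R n m) : key -> seq bool := fun k =>
  [seq (if k.1 then g \in initial I k.2 else utility I k.2 g == 1%R)
  | g <- enum 'I_m].

Lemma encodeE m (I : instance R n m) :
  encode I = flat keys (rows_of I) ++ map Some (binary (bound I)).
Proof.
rewrite /encode /flat /keys map_cat flatten_cat -!catA -!map_comp.
by congr (flatten _ ++ (flatten _ ++ _)); apply: eq_map => i;
  rewrite /= /block /rows_of -map_comp.
Qed.

Lemma nth_rows_of m (I : instance R n m) k (g : 'I_m) :
  nth false (rows_of I k) g =
    if k.1 then g \in initial I k.2 else utility I k.2 g == 1%R.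
Proof.
by rewrite (nth_map g) ?size_enum_ord ?ltn_ord // nth_ord_enum.
Qed.

Lemma rows_of_good m (I : instance R n m) : 0 < m ->
  good (rows_of I) (binary (bound I)) m.
Proof.
move=> m_gt0; split=> // [k|g lt|]; last exact: last_binary.
  by rewrite size_map size_enum_ord.
have /allocP [cov dis] := initial_alloc I.
have [i gi] := cov (Ordinal lt); apply/eqP.
rewrite -(card1 i); apply: eq_card => j; rewrite !inE /owned.
rewrite (nth_rows_of I (true, j) (Ordinal lt)) /=.
by apply/idP/eqP => [gj|-> //]; apply: dis gj gi.
Qed.

Lemma yes_instance_tally m (I : instance R n m) B : 0 < m ->
  binary_utilities I -> m.+1 < B ->
  yes_instance I <-> exists T c,
    [/\ T <= B.-1, T <= bound I, forall a, c a < B,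
        reached B (tally (rows_of I) m) T c & ef1_counts c].
Proof.
move=> m_gt0 u01 mB; rewrite (@yes_instance_counts _ _ _ I B B.-1 u01 mB); last by lia.
have -> // : counts (type_of (utility I)) (initial I) = tally (rows_of I) m.
apply: funext => a; apply: eq_bigr => g _; rewrite /owned nth_rows_of.
suff -> : liked (rows_of I) g = type_of (utility I) g by [].
by apply/ffunP => i; rewrite !ffunE nth_rows_of.
Qed.

Lemma language_word w : @binary_optimal_exchanges R n w -> exists rho bs m,
  w = flat keys rho ++ map Some bs /\ good rho bs m.
Proof.
move=> [m [I [m_gt0 _ -> _]]]; exists (rows_of I), (binary (bound I)), m.
by split; [exact: encodeE | exact: rows_of_good].
Qed.

Lemma language_good rho v : @binary_optimal_exchanges R n (flat keys rho ++ v) ->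
  exists bs m, v = map Some bs /\ good rho bs m.
Proof.
move/language_word => [rho' [bs [m [/flat_inj [E ->] h]]]]; exists bs, m.
by split=> //; rewrite (_ : rho = rho') //; apply: funext => k; apply: E (mem_keys k).
Qed.

(** Unique readability gives any instance with this encoding the same rows and bound. Conversely the
    rows define an instance that encodes to the given word, [sole_owner] making the bundles a
    partition. *)
Lemma language_flat rho bs m B : good rho bs m -> m.+1 < B ->
  @binary_optimal_exchanges R n (flat keys rho ++ map Some bs) <-> exists T c,
    [/\ T <= B.-1, T <= value bs, forall a, c a < B,
        reached B (tally rho m) T c & ef1_counts c].
Proof.
move=> [m_gt0 sz own bs_last] mB; split.
  move=> [m' [I [m'_gt0 u01 wE yes]]].
  move: wE; rewrite encodeE => /flat_inj [rhoE bsE].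
  have {}rhoE : rho = rows_of I by apply: funext => k; apply: rhoE (mem_keys k).
  (* There is an agent, and the length of its row of utilities is the number of goods. *)
  have mE : m' = m.
    have := sz (false, Ordinal n_gt0).
    by rewrite rhoE size_map size_enum_ord.
  subst m'; move/(yes_instance_tally m_gt0 u01 mB): yes.
  rewrite rhoE; have -> // : value bs = bound I.
  have -> : bs = binary (bound I) by apply: inj_map bsE => ? ? [].
  exact: value_binary.
pose u (i : 'I_n) (g : 'I_m) : R := (nth false (rho (false, i)) g)%:R%R.
have u_ge0 i g : (0 <= u i g)%R by exact: Num.Theory.ler0n.
pose A : bundles n m := [ffun i => [set g : 'I_m | owned rho g i]].
have aA : is_allocation A.
  have own1 (g : 'I_m) : exists i, forall j, owned rho g j = (j == i).
    have /card1P [i iE] := own g (ltn_ord g).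
    by exists i => j; have := iE j; rewrite !inE.
  apply/allocP; split=> [g|g i j].
    by have [i iE] := own1 g; exists i; rewrite ffunE inE iE.
  by have [l lE] := own1 g; rewrite !ffunE !inE !lE => /eqP -> /eqP ->.
pose I := Instance u_ge0 aA (value bs).
have u01 : binary_utilities I.
  by move=> i g; rewrite /= /u; case: nth; [right | left].
have rhoE : rows_of I = rho.
  apply: funext => k; apply: (@eq_from_nth _ false).
    by rewrite size_map size_enum_ord sz.
  move=> g; rewrite size_map size_enum_ord => lt.
  rewrite (nth_rows_of I k (Ordinal lt)) /= ffunE inE /u /owned.
  case: k => [[] i] //=; case: (nth _ _ _); first by rewrite eqxx.
  by rewrite eq_sym GRing.oner_eq0.
move=> yes; exists m, I; split=> //.
  by rewrite encodeE rhoE /= binary_value.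
by apply/(yes_instance_tally m_gt0 u01 mB); rewrite rhoE.
Qed.

End Words.

Arguments keys {n}.

(** * Reading the input *)

Section Reading.
Variable n : nat.
Notation name := (option (tname n)).
Notation store := (store letter name).
Notation prog := (prog letter name).
Notation reading := (reading letter name).
Notation key := (bool * 'I_n)%type.
Implicit Types (s : store) (w v : seq letter).

Definition blank : track letter := (0, tape_of [::]).

Lemma tape_nil : (fun=> None) = tape_of (Nil letter).
Proof. by apply: funext => -[|i] //=; rewrite nth_nil. Qed.

Lemma scan_tape_of w i : scan (i.+1, tape_of w) = Some (nth None (map Some w) i).
Proof. by []. Qed.

Lemma operate_stay (x : track letter) : operate x (None, Stay) = x.
Proof. by case: x => [[|p] f]. Qed.

Definition seek : action letter name := fun k =>
  match k with
  | None | Some (Main _) | Some (Scr _) => (None, MoveRight)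
  | _ => (None, Stay)
  end.
Definition rewind : action letter name := fun k =>
  match k with
  | None | Some (Main _) | Some (Scr _) => (None, MoveLeft)
  | _ => (None, Stay)
  end.
Definition draw : action letter name := fun k =>
  match k with
  | None => (None, MoveRight)
  | Some (Main _) | Some (Scr _) => (Some (Some None), MoveRight)
  | _ => (None, Stay)
  end.
Definition close : action letter name := fun k =>
  match k with
  | Some (Main _) | Some (Scr _) => (Some (Some (Some true)), Stay)
  | _ => (None, Stay)
  end.

(** The word itself measures the rulers: all of them grow by one letter per input letter, and the
    closing [true] makes |w| + 1 = B - 1 letters. All heads stay level, so the input head alone
    controls the way back. *)
Definition fill : prog :=
  Seq (Act (fun _ => seek))
  (Seq (Loop 1 (fun r => r None != Some None) (Act (fun _ => draw)))
  (Seq (Act (fun _ => close))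
       (Loop 1 (fun r => r None) (Act (fun _ => rewind))))).

Definition ruled (w : seq letter) (p : nat) (f : content letter) : store :=
  fun k => match k with
  | None => (p, tape_of w)
  | Some (Main _) | Some (Scr _) => (p, f)
  | _ => blank
  end.

Lemma run_fill w B : B = (size w).+2 ->
  run B fill (initial_store w) (ruled w 0 (ruler B)).
Proof.
move=> BE; have B_gt1 : 1 < B by lia.
set N := size w in BE.
pose g i := tape_of (nseq i (None : letter)).
have actE f s s' : (forall k, operate (s k) (f k) = s' k) ->
    run B (Act (fun _ => f)) s s'.
  by move=> h; have := run_act B (fun _ => f) s; rewrite (funext h).
apply: (@run_seq _ _ _ _ _ _ _ (ruled w 1 (g 0))) => //.
  by apply: actE => -[[]|] //=; rewrite /operate /= tape_nil.
apply: (@run_seq _ _ _ _ _ _ _ (ruled w N.+1 (g N))) => //.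
  apply: (run_loop B_gt1 (F := fun i => ruled w i.+1 (g i))) => [|i lt|].
  - by rewrite expn1; lia.
  - split; first by rewrite /scans /= scan_tape_of (nth_map None).
    have pg : put (g i) i.+1 (Some None) = g i.+1.
      have := put_tape_of_rcons (nseq i (None : letter)) None; rewrite size_nseq => ->.
      by congr tape_of; elim: (i) => //= j ->.
    by apply: actE => -[[]|] //= *; rewrite /operate /= pg.
  - by rewrite /scans /= scan_tape_of nth_default // size_map.
have pr : put (g N) N.+1 (Some (Some true)) = ruler B.
  have := put_tape_of_rcons (nseq N (None : letter)) (Some true).
  by rewrite size_nseq /ruler BE.
apply: (@run_seq _ _ _ _ _ _ _ (ruled w N.+1 (ruler B))) => //.
  by apply: actE => -[[]|] //= *; rewrite /operate /= pr.
have -> : ruled w N.+1 (ruler B) = ruled w (N.+1 - 0) (ruler B) by [].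
have -> : ruled w 0 (ruler B) = ruled w (N.+1 - N.+1) (ruler B) by rewrite subnn.
apply: (run_loop B_gt1 (F := fun i => ruled w (N.+1 - i) (ruler B))) => [|i lt|].
- by rewrite expn1; lia.
- split; first by rewrite /scans /= scan_isSome /=; lia.
  by apply: actE => -[[]|] //= *; rewrite /operate /= subnS; case: (0 < _).
- by rewrite /scans /= subnn.
Qed.

Definition is_bit (a : option (option letter)) : bool :=
  if a is Some (Some (Some _)) then true else false.

Definition copy (k : name) : prog :=
  Seq (Loop 1 (fun r => is_bit (r None))
         (Act (fun r k' => if k' == k then (r None, MoveRight)
                           else if k' == None then (None, MoveRight)
                           else (None, Stay))))
  (Seq (rew 1 k) (mv k MoveRight)).

Variable B : nat.
Hypothesis B_gt1 : 1 < B.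
Notation run := (@run letter name B).

Definition starts_with_bit v : bool := if v is Some _ :: _ then true else false.

Lemma split_bits v : exists bs v', v = map Some bs ++ v' /\ ~~ starts_with_bit v'.
Proof.
elim: v => [|[b|] v [bs [v' [-> h]]]]; first by exists [::], [::].
  by exists (b :: bs), v'.
by exists [::], (None :: map Some bs ++ v').
Qed.

Lemma put_bits_take bs i : i < size bs ->
  put (bits (take i bs)) i.+1 (Some (Some (nth false bs i))) = bits (take i.+1 bs).
Proof.
move=> lt; have := put_tape_of_rcons (map Some (take i bs)) (Some (nth false bs i)).
rewrite size_map size_takel; last exact: ltnW.
by move=> ->; rewrite -map_rcons -take_nth.
Qed.

Lemma run_copy (k : tname n) s w q bs v :
  s None = (q.+1, tape_of w) -> s (Some k) = (1, tape_of [::]) ->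
  drop q w = map Some bs ++ v -> ~~ starts_with_bit v -> size w < B ->
  run (copy (Some k)) s
    (upd (setp s None (q + size bs).+1) (Some k) (1, bits bs)).
Proof.
move=> sI sk wE vE lt.
have nthE i : nth None (map Some w) (q + i) = nth None (map Some (map Some bs ++ v)) i.
  by rewrite -wE map_drop nth_drop.
have szE : size bs <= size w.
  by have := congr1 size wE; rewrite size_drop size_cat size_map; lia.
pose F i := upd (setp s None (q + i).+1) (Some k) (i.+1, bits (take i bs)).
have FI i : F i None = ((q + i).+1, tape_of w) by rewrite /F upd_other // setp_same sI.
have s0 : s = F 0.
  by rewrite /F take0 addn0 (setp_eq sI) -sk upd_id.
apply: (@run_seq _ _ _ _ _ _ _ (F (size bs))) => //.
  rewrite {1}s0; apply: (run_loop B_gt1) => [|i lti|].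
  - by rewrite expn1; lia.
  - rewrite /scans FI scan_tape_of nthE map_cat nth_cat !size_map lti.
    have E : nth None (map Some (map Some bs)) i = Some (Some (nth false bs i)).
      by rewrite (nth_map None) ?size_map // (nth_map false).
    rewrite E; split=> //.
    have := @run_act _ _ B (fun r k' => if k' == Some k then (r None, MoveRight)
                           else if k' == None then (None, MoveRight)
                           else (None, Stay)) (F i).
    congr (run _ _ _); apply: funext => k'; rewrite /scans FI scan_tape_of.
    rewrite nthE map_cat nth_cat !size_map lti E.
    case: eqP => [->|kk'].
      by rewrite /F !upd_same /operate /= put_bits_take.
    have {kk'} kk' : k' != Some k by apply/eqP.
    case: eqP => [->|kN]; first by rewrite FI FI /operate /= addnS.
    rewrite /F !upd_other // ?setp_other //; try by apply/eqP.
    by rewrite /operate /=; case: (s k') => [[|?] ?].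
  - rewrite /scans FI scan_tape_of nthE map_cat nth_cat !size_map ltnn subnn.
    by case: (v) vE => [|[b|] v'].
apply: (@run_seq _ _ _ _ _ _ _ (setp (F (size bs)) (Some k) 0)) => //.
  by apply: run_rew => //; rewrite /F upd_same expn1 /=; lia.
have -> : upd (setp s None (q + size bs).+1) (Some k) (1, bits bs) =
    setp (setp (F (size bs)) (Some k) 0) (Some k) 1.
  by rewrite setp_setp /F /setp upd_upd upd_same take_size.
by apply: run_mv_to; rewrite setp_same.
Qed.

Lemma scan_after (s : store) w q u v : s None = ((q + size u).+1, tape_of w) ->
  drop q w = u ++ v -> scans s None = Some (nth None (map Some v) 0).
Proof.
move=> sI wE; rewrite /scans sI scan_tape_of.
have := nth_drop q None (map Some w) (size u).
by rewrite -map_drop wE map_cat nth_cat !size_map ltnn subnn => ->.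
Qed.

(** In continuation style a missing separator abandons all that follows, which leaves [Acc] down and
    thus rejects. *)
Fixpoint parse (ks : seq key) (cont : prog) : prog :=
  if ks is k :: ks' then
    Seq (copy (Some (Row k)))
      (If (fun r => r None == Some (Some None))
         (Seq (mv None MoveRight) (parse ks' cont)) skip)
  else cont.

(** [Q] covers success and failure. After a failure only [Acc] is known, which is enough to conclude
    that the word is rejected. *)
Lemma run_parse w cont (Q : store -> Prop) ks q s : size w < B -> uniq ks ->
  s None = (q.+1, tape_of w) ->
  (forall k, k \in ks -> s (Some (Row k)) = (1, tape_of [::])) ->
  (forall rho v s', drop q w = flat ks rho ++ v ->
     s' None = ((q + size (flat ks rho)).+1, tape_of w) ->
     (forall k, k \in ks -> s' (Some (Row k)) = (1, bits (rho k))) ->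
     (forall k', (forall k, k' <> Row k) -> s' (Some k') = s (Some k')) ->
     (forall k, k \notin ks -> s' (Some (Row k)) = s (Some (Row k))) ->
     exists2 s'', run cont s' s'' & Q s'') ->
  ((forall rho v, drop q w <> flat ks rho ++ v) ->
     forall s', s' (Some Acc) = s (Some Acc) -> Q s') ->
  exists2 s', run (parse ks cont) s s' & Q s'.
Proof.
move=> lt; elim: ks q s => [|k ks IHks] q s /= ks_uniq sI sR ok bad.
  by apply: (ok (fun=> [::]) (drop q w)) => //; rewrite addn0.
have /andP[k_ks {}ks_uniq] := ks_uniq.
have [bs [v [wE vE]]] := split_bits (drop q w).
have sRk := sR k (mem_head _ _).
have r1 := run_copy sI sRk wE vE lt.
set s1 := upd _ _ _ in r1.
have s1I : s1 None = ((q + size bs).+1, tape_of w).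
  by rewrite /s1 upd_other // setp_same sI.
have scE : scans s1 None = Some (nth None (map Some v) 0).
  by apply: scan_after wE; rewrite s1I size_map.
case: v wE vE scE => [|[b|] v] wE // _ scE.
  exists s1; last first.
    apply: bad => [rho v|]; last by rewrite /s1 upd_other // setp_other.
    rewrite wE cats0 flat_cons => E.
    have : None \in map Some bs by rewrite E mem_cat mem_cat mem_rcons mem_head.
    by case/mapP.
  by apply: run_seq r1 _ => //; apply: run_if => //; rewrite scE /=; exact: run_skip.
pose s2 := setp s1 None (q + size bs).+2.
have wE2 : drop (q + size bs).+1 w = v.
  rewrite -addn1 -addnA addnC -drop_drop wE addn1 -cat1s catA drop_size_cat //.
  by rewrite size_cat size_map addn1.
have s2I : s2 None = ((q + size bs).+2, tape_of w) by rewrite /s2 setp_same s1I.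
have s2k k' : k' != Row k -> s2 (Some k') = s (Some k').
  move=> h; rewrite /s2 setp_other // /s1 upd_other ?setp_other //.
have [k' k'_ks|rho v' s' E1 sI' sR' sO' sO2'|nE s'|s3 r3 Q3] :=
    IHks (q + size bs).+1 s2 ks_uniq s2I.
- rewrite s2k; first by apply: sR; rewrite inE k'_ks orbT.
  by apply: contraNneq k_ks => -[<-].
- have flatE : flat (k :: ks) (fun k' => if k' == k then bs else rho k') =
      block bs ++ flat ks rho.
    rewrite flat_cons eqxx; congr (_ ++ flatten _); apply/eq_in_map => k' k'_ks.
    by case: eqP k'_ks k_ks => // -> ->.
  apply: (ok (fun k' => if k' == k then bs else rho k') v') => //.
  + by rewrite flatE wE -catA -E1 wE2 /block cat_rcons.
  + by rewrite sI' flatE size_cat size_rcons size_map addnS !addnA.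
  + move=> k'; rewrite inE => /predU1P[->|k'_ks]; last first.
      rewrite sR' //; case: eqP k'_ks k_ks => // -> -> //.
    by rewrite eqxx sO2' // /s2 setp_other // /s1 upd_same.
  + move=> k' h; rewrite sO' // s2k //; apply/eqP; exact: h.
  + by move=> k'; rewrite inE negb_or => /andP[kk' k'_ks]; rewrite sO2' // s2k.
- move=> sA; apply: bad => [rho v' E|]; last by rewrite sA s2k.
  move: E; rewrite wE flat_cons -catA -[map _ _ ++ None :: v]cat_rcons.
  move=> /block_inj [_ E]; apply: (nE rho v'); rewrite wE2 E //.
exists s3 => //; apply: run_seq r1 _ => //; apply: run_if => //; rewrite scE /=.
by apply: run_seq r3 => //; apply: run_mv_to; rewrite s1I.
Qed.

Definition all_blank (r : reading) : bool :=
  [forall x : key, r (Some (Row x)) == Some None].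
Definition good_column (r : reading) : bool :=
  [forall x : key, is_bit (r (Some (Row x)))] &&
  (#|[pred i | r (Some (Row (true, i))) == lit]| == 1).
Definition in_column (a : digit n) (r : reading) : bool :=
  (r (Some (Row (true, a.2))) == lit) &&
  ([ffun i => r (Some (Row (false, i))) == lit] == a.1).
Definition advance : action letter name := fun k =>
  if k is Some (Row _) then (None, MoveRight) else (None, Stay).

(** The address of the initial counts is accumulated by the table head itself: each good moves it by
    the place value of the good's type and owner. *)
Definition column : prog :=
  Seq (each (@digits n) (fun a => If (in_column a) (stride (after a) MoveRight) skip))
      (Act (fun _ => advance)).

Definition scanned s (rho : key -> seq bool) (g p : nat) (f : content letter) :
    store := fun k =>
  match k with
  | Some (Row x) => (g.+1, bits (rho x))
  | Some Tab => (p, f)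
  | _ => s k
  end.

Definition gain (rho : key -> seq bool) (g : nat) : nat :=
  \sum_(a <- @digits n) (owned rho g a.2 && (liked rho g == a.1)) * weight B a.

Lemma scan_row s rho g p f x : scans (scanned s rho g p f) (Some (Row x)) =
  Some (if g < size (rho x) then Some (Some (nth false (rho x) g)) else None).
Proof. exact: scan_bits. Qed.

Lemma scan_row_lit s rho g p f x :
  (scans (scanned s rho g p f) (Some (Row x)) == lit) = nth false (rho x) g.
Proof.
rewrite scan_row; case: ltnP => h; last by rewrite nth_default.
by case: nth.
Qed.

Lemma all_blankE s rho g p f : all_blank (scans (scanned s rho g p f)) =
  [forall x, size (rho x) <= g].
Proof.
by apply: eq_forallb => x; rewrite scan_row; case: ltnP.
Qed.

Definition ok_column (rho : key -> seq bool) g : bool :=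
  [forall x, g < size (rho x)] && sole_owner rho g.

Lemma good_columnE s rho g p f :
  good_column (scans (scanned s rho g p f)) = ok_column rho g.
Proof.
congr (_ && _); first by apply: eq_forallb => x; rewrite scan_row; case: ltnP.
by congr (_ == _); apply: eq_card => i; rewrite !inE scan_row_lit.
Qed.

Lemma run_column s rho g p f : ready B s ->
  run column (scanned s rho g p f) (scanned s rho g.+1 (p + gain rho g) f).
Proof.
move=> rs; pose F l := scanned s rho g
  (p + \sum_(a <- l) (owned rho g a.2 && (liked rho g == a.1)) * weight B a) f.
apply: (@run_seq _ _ _ _ _ _ _ (F (@digits n))) => //.
  have -> : scanned s rho g p f = F [::] by rewrite /F big_nil addn0.
  apply: run_each => // l1 a l2 _; apply: run_if => //.
  have -> : in_column a (scans (F l1)) = owned rho g a.2 && (liked rho g == a.1).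
    rewrite /in_column /F scan_row_lit; congr (_ && (_ == _)).
    by apply/ffunP => i; rewrite !ffunE scan_row_lit.
  have FE q : scanned s rho g q f = setp (scanned s rho g q f) (Some Tab) q.
    by rewrite (@setp_eq _ _ _ _ _ f).
  rewrite /F -cats1 big_cat big_seq1 /=; case: (_ && _); last first.
    by rewrite mul0n addn0; exact: run_skip.
  set q := p + _; rewrite mul1n addnA -/q.
  have := @run_stride_at _ _ B_gt1 (after a) MoveRight (scanned s rho g q f) q (after_uniq a).
  rewrite -/(weight B a) -FE; have -> : setp (scanned s rho g q f) (Some Tab) (q + weight B a) =
     scanned s rho g (q + weight B a) f.
    by apply: funext => k; rewrite /setp /upd; case: eqP => [->|]; case: k => [[]|].
  by apply=> x; apply: rs.
have := run_act B (fun _ => advance) (F (@digits n)).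
congr (run _ _ _); apply: funext => -[[]|] //= *; rewrite ?operate_stay //.
Qed.

Lemma address_tally rho m : address B (tally rho m) = \sum_(g < m) gain rho g.
Proof.
rewrite /address /gain exchange_big /=; apply: eq_bigr => a _.
by rewrite /tally big_distrl.
Qed.

Definition finish : prog :=
  Seq (wr (Some Tab) (Some (Some true)))
  (Seq (rew (size (@digits n)).+1 (Some Tab)) (Seq (mv (Some Tab) MoveRight) search)).

(** The first test rejects m = 0. The loop stops at the first improper column; the word is
    well-formed only if all rows end there together. *)
Definition columns : prog :=
  If all_blank skip
    (Seq (mv (Some Tab) MoveRight)
    (Seq (Loop 1 good_column column) (If all_blank finish skip))).

(** Supplies the number of rounds of the scanning loop, which must be known before the rows are
    known to have equal lengths. *)
Lemma ok_columns_end rho : 0 < n -> exists m,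
  [/\ forall g, g < m -> ok_column rho g, ~~ ok_column rho m &
      forall k, m <= size (rho k)].
Proof.
move=> n_gt0; pose k0 : key := (false, Ordinal n_gt0).
have ex : exists g, ~~ ok_column rho g.
  exists (size (rho k0)); rewrite negb_and; apply/orP; left.
  by rewrite negb_forall; apply/existsP; exists k0; rewrite ltnn.
case: (ex_minnP ex) => m no min; exists m.
have ok g : g < m -> ok_column rho g.
  by move=> lt; apply: contraLR lt => /min; rewrite -leqNgt.
split=> // k; case: m ok {no min} => // m ok.
by have /andP[/forallP /(_ k)] := ok m (ltnSn m).
Qed.

End Reading.

(** * The decider and its correctness *)

Section Decision.
Variables (R : realType) (n : nat).
Hypothesis n_gt0 : 0 < n.
Notation name := (option (tname n)).
Notation store := (store letter name).
Notation prog := (prog letter name).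
Notation key := (bool * 'I_n)%type.
Notation L := (@binary_optimal_exchanges R n).

Variables (w : seq letter) (B : nat).
Hypothesis BE : B = (size w).+2.

Lemma B_gt1 : 1 < B. Proof. by rewrite BE. Qed.

Definition decided (s : store) : Prop := 0 < (s (Some Acc)).1 <-> L w.

Definition fresh (s : store) : Prop :=
  [/\ ready B s, forall x, s (Some (Main x)) = (0, ruler B) &
   forall k, k \in [:: Tab; Za; Zb; Yc; Bit; Fail; Dead; Acc] ->
     s (Some k) = blank].

Lemma rejected s : (s (Some Acc)).1 = 0 -> ~ L w -> decided s.
Proof. by rewrite /decided => ->. Qed.

Lemma size_row (rho : key -> seq bool) v k : w = flat keys rho ++ v -> size (rho k) < size w.
Proof.
move=> ->; have := mem_keys k; rewrite size_cat.
elim: keys => // k' ks IH; rewrite inE flat_cons size_cat size_rcons size_map.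
by case/predU1P => [->|/IH]; lia.
Qed.

Lemma run_columns (rho : key -> seq bool) bs s : w = flat keys rho ++ map Some bs -> last true bs ->
  fresh s -> (forall k, s (Some (Row k)) = (1, bits (rho k))) ->
  s (Some Bt) = (1, bits bs) ->
  exists2 s', run B (@columns n) s s' & decided s'.
Proof.
move=> wE bs_last [rs sM sK] sR sB.
have lt2 := B_gt1.
pose k0 : key := (false, Ordinal n_gt0).
have sA : s (Some Acc) = blank by apply: sK.
have sE : s = scanned s rho 0 0 (tape_of [::]).
  by apply: funext => -[[]|] //= *; rewrite ?sR ?sK.
have LE : L w -> exists m, good rho bs m.
  rewrite wE => /language_good [bs' [m [E h]]]; exists m.
  by have -> : bs = bs' by apply: inj_map E => ? ? [].
have skipped (s' : store) : (s' (Some Acc)).1 = 0 -> ~ L w ->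
    exists2 s'', run B skip s' s'' & decided s''.
  by move=> h1 h2; exists s'; [exact: run_skip | exact: rejected].
have [m [ok no_m sz_m]] := ok_columns_end rho n_gt0.
have m_lt : m < size w.
  by apply: leq_ltn_trans (sz_m k0) (size_row k0 wE).
case bl : (all_blank (scans s)).
  have [||s' r' d'] := @skipped s; first by rewrite sA.
    move: bl; rewrite sE all_blankE => /forallP bl /LE [m' [m'_gt0 sz _ _]].
    by have := bl k0; rewrite sz; lia.
  by exists s' => //; apply: run_if; rewrite ?bl.
pose S g := scanned s rho g (\sum_(i < g) gain B rho i).+1 (tape_of [::]).
have r0 : run B (mv (Some Tab) MoveRight) s (S 0).
  have -> : S 0 = setp s (Some Tab) 1.
    apply: funext => k; rewrite /S /setp /upd sK // big_ord0.
    by case: eqP => [->|] //; case: k => [[]|] //= x _; rewrite sR.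
  by apply: run_mv_to; rewrite sK.
have r1 : run B (Loop 1 (@good_column n) (@column n)) (S 0) (S m).
  apply: (run_loop lt2) => [|g lt|].
  - by rewrite expn1; lia.
  - rewrite good_columnE ok //; split=> //.
    by rewrite /S big_ord_recr /= -addSn; apply: run_column.
  - by rewrite good_columnE.
have done_ : (exists2 s', run B (If (@all_blank n) (@finish n) skip) (S m) s' & decided s') ->
    exists2 s', run B (@columns n) s s' & decided s'.
  move=> [s' r' d']; exists s' => //; apply: run_if => //; rewrite bl.
  by apply: run_seq r0 _ => //; apply: run_seq r1 _.
apply: done_; case bl' : (all_blank (scans (S m))); last first.
  have [||s' r' d'] := @skipped (S m); first by rewrite /S /= sA.
    move=> /LE [m' [_ sz own _]].
    have mm' : m <= m' by rewrite -(sz k0).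
    have [lt|ge] := ltnP m m'.
      move: no_m; rewrite /ok_column own // andbT => /negP; apply; apply/forallP => x.
      by rewrite sz.
    by move: bl'; rewrite all_blankE => /negP; apply; apply/forallP => x; rewrite sz.
  by exists s' => //; apply: run_if; rewrite ?bl'.
have sz k : size (rho k) = m.
  by apply/eqP; rewrite eqn_leq sz_m andbT; move: bl'; rewrite all_blankE => /forallP.
have m_gt0 : 0 < m.
  rewrite lt0n; apply: contraFN bl => /eqP m0.
  by rewrite sE all_blankE; apply/forallP => x; rewrite sz m0.
have good_rho : good rho bs m.
  by split=> // g /ok /andP[].
have mB : m.+1 < B by lia.
set c := tally rho m.
have cB a : c a < B.
  apply: (@leq_ltn_trans m); last by lia.
  rewrite -[X in _ <= X]card_ord -sum1_card; apply: leq_sum => g _; exact: leq_b1.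
set A := address B c.
have AE : \sum_(i < m) gain B rho i = A by rewrite -address_tally.
pose f := put (tape_of [::]) A.+1 (Some (Some true)) : content letter.
pose s0 := scanned s rho m 1 f.
have r2 p : p <= B ^ (size (@digits n)).+1 ->
    run B (rew (size (@digits n)).+1 (Some Tab)) (scanned s rho m p f) (scanned s rho m 0 f).
  move=> le; have -> : scanned s rho m 0 f = setp (scanned s rho m p f) (Some Tab) 0.
    by apply: funext => k; rewrite /setp /upd; case: eqP => [->|] //; case: k => [[]|].
  exact: run_rew.
have A_lt : A < B ^ size (@digits n) := address_lt lt2 cB.
have [s' r' accE] : exists2 s', run B (@search n) s0 s' &
    0 < (s' (Some Acc)).1 <-> accepted B c (value bs) (B * weight_top n B).
  apply: run_search => //.
  split.
  - by move=> a; rewrite /s0 /= rs.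
  - by split; rewrite /s0 /= sK.
  - by rewrite /s0 /= !sK.
  (* No entry is processed yet and only the seed is written; by uniqueness of addresses no other
     entry shares its cell. *)
  - exists f; split=> // T c' cB'; rewrite /f /put eqSS ltn0.
    case: (eqVneq (T * weight_top n B + address B c') A) => [E|/eqP ne].
      have [-> ->] : T = 0 /\ c' = c by apply: (address_inj lt2) => //; rewrite E mul0n.
      by rewrite /= eqxx; apply/esym/forallP => a; exact: eqxx.
    rewrite [LHS](_ : _ = false); last by rewrite /tape_of /= nth_nil.
    apply/esym/negP => /andP[/eqP T0 /forallP cE]; apply: ne.
    rewrite T0 /A; congr (address B _); apply: funext => a; exact/eqP.
  - split; last first.
      rewrite /s0 /= sA /=; split=> //; split=> // -[T [c' []]].
      by rewrite ltn0.
    exists bs; rewrite /s0 /= sB sK //=; split=> //; last by rewrite addn0.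
    by have := congr1 size wE; rewrite size_cat size_map; lia.
exists s'; last first.
  rewrite /decided accE (acceptedP lt2) wE (language_flat R n_gt0 good_rho mB).
  by [].
apply: run_if => //; rewrite bl' /S AE.
apply: (@run_seq _ _ _ lt2 _ _ _ (scanned s rho m A.+1 f)).
  have -> : scanned s rho m A.+1 f =
     upd (scanned s rho m A.+1 (tape_of [::])) (Some Tab) (A.+1, f).
    by apply: funext => k; rewrite /upd; case: eqP => [->|] //; case: k => [[]|].
  exact: run_wr.
apply: (@run_seq _ _ _ lt2 _ _ _ (scanned s rho m 0 f)).
  by apply: r2; rewrite expnS; nia.
apply: run_seq r' => //.
have -> : s0 = setp (scanned s rho m 0 f) (Some Tab) 1.
  by apply: funext => k; rewrite /s0 /setp /upd; case: eqP => [->|] //; case: k => [[]|].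
exact: run_mv_to.
Qed.

(** The bits of the bound must end at a blank, where the word ends. One step back is the last letter
    of the word, and a 0 there is a leading zero of the bound. *)
Definition tail : prog :=
  Seq (copy (Some Bt))
    (If (fun r => r None == Some None)
       (Seq (mv None MoveLeft)
          (If (fun r => r None != Some (Some (Some false))) (@columns n) skip)) skip).

Lemma run_tail (rho : key -> seq bool) v s : w = flat keys rho ++ v ->
  s None = ((size (flat keys rho)).+1, tape_of w) ->
  (forall k, s (Some (Row k)) = (1, bits (rho k))) ->
  s (Some Bt) = (1, tape_of [::]) -> fresh s ->
  exists2 s', run B tail s s' & decided s'.
Proof.
move=> wE sI sR sB fs.
have lt2 := B_gt1.
pose k0 : key := (false, Ordinal n_gt0).
have [bs [v' [vE v'E]]] := split_bits v.
set q := size (flat keys rho) in sI.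
have dE : drop q w = map Some bs ++ v' by rewrite wE drop_size_cat.
have wB : size w < B by lia.
have r1 := run_copy lt2 sI sB dE v'E wB.
set s1 := upd _ _ _ in r1.
have s1I : s1 None = ((q + size bs).+1, tape_of w) by rewrite /s1 upd_other // setp_same sI.
have s1E k : k != Bt -> s1 (Some k) = s (Some k).
  by move=> ?; rewrite /s1 upd_other // setp_other.
have sc1 : scans s1 None = Some (nth None (map Some v') 0).
  by apply: scan_after dE; rewrite s1I size_map.
have fresh_eq s2 : (forall k, k != Bt -> s2 (Some k) = s (Some k)) -> fresh s2.
  move=> h; case: fs => rs sM sK; split=> [a|x|k kK]; rewrite h //; first exact: sK.
  by apply: contraTneq kK => ->.
have acc0 s2 : fresh s2 -> (s2 (Some Acc)).1 = 0 by case=> _ _ ->.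
case: v' vE v'E dE r1 sc1 => [|[b|] v'] vE // _ dE r1 sc1; last first.
  exists s1; first by apply: run_seq r1 _ => //; apply: run_if => //; rewrite sc1; exact: run_skip.
  apply: rejected; first by apply: acc0; apply: fresh_eq.
  rewrite wE vE => /language_good [bs' [m [E _]]].
  have : None \in map Some bs' by rewrite -E mem_cat mem_head orbT.
  by case/mapP.
rewrite cats0 in vE.
pose s2 := setp s1 None (q + size bs).
have s2I : s2 None = (q + size bs, tape_of w) by rewrite /s2 setp_same s1I.
have s2E k : k != Bt -> s2 (Some k) = s (Some k) by move=> h; rewrite /s2 setp_other // s1E.
have r2 : run B (mv None MoveLeft) s1 s2 by apply: run_mv_to; rewrite s1I.
have qE : q + size bs = size w by rewrite wE size_cat vE size_map.
have lastE : last None w = last None (map Some bs) by rewrite wE last_cat last_flat vE.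
have sc2 : (scans s2 None != Some (Some (Some false))) = last true bs.
  rewrite /scans s2I qE.
  have := size_row k0 wE; case sz : (size w) => [|l] // _; rewrite scan_tape_of.
  have lE : l = (size w).-1 by rewrite sz.
  rewrite (nth_map None) ?sz // lE nth_last lastE.
  by case/lastP: (bs) => // bs' b; rewrite map_rcons !last_rcons; case: b.
have done_ : (exists2 s', run B (if last true bs then @columns n else skip) s2 s' & decided s') ->
    exists2 s', run B tail s s' & decided s'.
  move=> [s' r' d']; exists s' => //; apply: run_seq r1 _ => //.
  apply: run_if => //; rewrite sc1; apply: run_seq r2 _ => //.
  by apply: run_if => //; rewrite sc2.
apply: done_; case lb : (last true bs).
  have wE' : w = flat keys rho ++ map Some bs by rewrite wE vE.
  by apply: (run_columns wE') => //; exact: fresh_eq.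
exists s2; first exact: run_skip.
apply: rejected; first by apply: acc0; apply: fresh_eq.
rewrite wE vE => /language_good [bs' [m [E [_ _ _ lb']]]].
have bE : bs = bs' by apply: inj_map E => ? ? [].
by rewrite bE lb' in lb.
Qed.

Definition begin : action letter name := fun k =>
  match k with
  | None | Some (Row _) | Some Bt => (None, MoveRight)
  | _ => (None, Stay)
  end.

Definition decider : prog :=
  Seq (@fill n) (Seq (Act (fun _ => begin)) (parse keys tail)).

Lemma run_decider : exists2 s', run B decider (initial_store w) s' & decided s'.
Proof.
have lt2 := B_gt1.
have wB : size w < B by lia.
pose s1 : store := fun k => match k with
  | None => (1, tape_of w)
  | Some (Row _) | Some Bt => (1, tape_of [::])
  | _ => ruled w 0 (ruler B) k
  end.
have r1 : run B (Act (fun _ => begin)) (ruled w 0 (ruler B)) s1.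
  have := run_act B (fun _ => begin) (ruled w 0 (ruler B)).
  by congr (run _ _ _); apply: funext => -[[]|].
have fs s2 : (forall k, (forall x, k <> Row x) -> s2 (Some k) = s1 (Some k)) -> fresh s2.
  move=> h; split=> [a|x|k kK]; [by rewrite h | by rewrite h | rewrite h].
    by case: k kK.
  by move=> x kE; rewrite kE in kK.
have [|||s2 r2 d2] := @run_parse n B lt2 w tail decided keys 0 s1 wB (keys_uniq n) erefl.
- by [].
- move=> rho v s2 wE sI sR sO _; rewrite drop0 in wE.
  apply: run_tail wE sI _ _ _; first by move=> k; apply: sR; exact: mem_keys.
    by rewrite sO.
  exact: fs.
- move=> no s2 sA; apply: rejected; first by rewrite sA.
  move/language_word => [rho [bs [m [wE _]]]].
  by apply: (no rho (map Some bs)); rewrite drop0.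
exists s2 => //.
apply: (run_seq lt2 (@run_fill n _ _ BE)); exact: (run_seq lt2 r1 r2).
Qed.

End Decision.

Theorem theorem4p4 (R : realType) (n : nat) (hn : 1 < n) :
  in_P (@binary_optimal_exchanges R n).
Proof.
apply: (in_P_prog (p := @decider n) (acc := fun r => r (Some Acc))) => w.
have [s r d] := run_decider R (ltnW hn) (erefl (size w).+2).
by exists s; split=> //; rewrite scan_isSome.
Qed.
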